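(* Let $\mathcal H$ be a finite-dimensional Hilbert space, let $\varrho,\sigma$ be density operators on $\mathcal H$, and let $\alpha\in(0,1)$. Then the limit $\lim_{n\to+\infty}\frac{1}{n}D_{\alpha}^{\mathrm{test}}(\varrho^{\otimes n}\|\sigma^{\otimes n})$ exists (in $[0,+\infty]$), and \[ \overline{D}_{\alpha}^{\mathrm{test}}(\varrho\|\sigma) =\lim_{n\to+\infty}\frac{1}{n}D_{\alpha}^{\mathrm{test}}(\varrho^{\otimes n}\|\sigma^{\otimes n}) =\sup_{r>0}\min\Big\{r,\frac{\alpha}{1-\alpha}H_r(\varrho\|\sigma)\Big\} =\sup\Big\{r\ge 0:\ H_r(\varrho\|\sigma)\ge \frac{1-\alpha}{\alpha}r\Big\}. \]
   Context: For a PSD operator $A=\sum_a aP_a$ (spectral decomposition) and $x\in\mathbb R$, $A^x:=\sum_{a>0}a^xP_a$; in particular $A^0$ is the support projection. For probability vectors $p,q$ on a finite set and $\alpha\in(0,1)$, the classical Rényi divergence is $D_\alpha(p\|q)=\frac{1}{\alpha-1}\log\sum_\omega p(\omega)^\alpha q(\omega)^{1-\alpha}$ (equal to $+\infty$ if the sum is $0$). A test on $\mathcal H$ is an operator $T$ with $0\le T\le I$; for a test $T$ and an operator $X$ put $\mathcal T(X):=(\operatorname{Tr}XT,\operatorname{Tr}X(I-T))$. The test-measured Rényi $\alpha$-divergence is $D_\alpha^{\mathrm{test}}(\varrho\|\sigma):=\max_{0\le T\le I}D_\alpha(\mathcal T(\varrho)\|\mathcal T(\sigma))$, and its regularization is $\overline{D}_\alpha^{\mathrm{test}}(\varrho\|\sigma):=\limsup_{n\to\infty}\frac1n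 D_\alpha^{\mathrm{test}}(\varrho^{\otimes n}\|\sigma^{\otimes n})$. The (Petz-type) Rényi divergence for $\alpha\in(0,1)$ is $D_\alpha(\varrho\|\sigma)=\frac{1}{\alpha-1}\log\operatorname{Tr}\varrho^\alpha\sigma^{1-\alpha}$, and the Hoeffding divergence is $H_r(\varrho\|\sigma):=\sup_{\beta\in(0,1)}\frac{\beta-1}{\beta}\big[r-D_\beta(\varrho\|\sigma)\big]$ for $r\in\mathbb R$. *)

(* Defs.v *)
(* matrices over R[i] (R : realType), MathComp-Analysis for
   powR, ln, extended reals, suprema and limits. *)
From HB Require Import structures.
From mathcomp Require Import all_boot all_order all_algebra.
From mathcomp Require Import complex mxtens.
From mathcomp Require Import all_classical all_reals all_analysis.

Set Implicit Arguments.
Unset Strict Implicit.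
Unset Printing Implicit Defensive.

Import Order.TTheory GRing.Theory Num.Theory.
Local Open Scope ring_scope.
Local Open Scope complex_scope.
Local Open Scope sesquilinear_scope.
Local Open Scope classical_set_scope.

Section QDefs.
Variable R : realType.
Local Notation C := (R[i]).

(* positive semidefinite: self-adjoint and nonnegative quadratic form *)
Definition psdmx (d : nat) (A : 'M[C]_d) : Prop :=
  A = A ^t* /\ forall v : 'rV[C]_d, 0 <= (v *m A *m v ^t*) 0 0.

(* density operator *)
Definition densitymx (d : nat) (A : 'M[C]_d) : Prop :=
  psdmx A /\ \tr A = 1.

(* test: 0 <= T <= I *)
Definition testmx (d : nat) (T : 'M[C]_d) : Prop :=
  psdmx T /\ psdmx (1%:M - T).

(* Functional calculus A^x := sum_{a>0} a^x P_a, computed from the library's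
   unitary diagonalisation A = P^-1 diag(sp) P (valid for normal, in
   particular PSD, A); eigenvalues that are not > 0 are sent to 0. *)
Definition mxpowR (d : nat) (A : 'M[C]_d) (x : R) : 'M[C]_d :=
  invmx (spectralmx A) *m
  diag_mx (\row_j (let a := spectral_diag A 0 j in
                   if 0 < a then (powR (complex.Re a) x)%:C else 0))
  *m spectralmx A.

(* classical Renyi divergence of probability vectors on a finite set,
   +oo when the sum vanishes *)
Definition crenyi (W : finType) (alpha : R) (p q : W -> R) : \bar R :=
  let s := \sum_(w : W) powR (p w) alpha * powR (q w) (1 - alpha) in
  if s == 0 then +oo%E else ((alpha - 1)^-1 * ln s)%:E.

(* the two-outcome distribution (Tr X T, Tr X (I - T)) *)
Definition testdist (d : nat) (T X : 'M[C]_d) : bool -> R :=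
  fun b => if b then complex.Re (\tr (X *m T))
           else complex.Re (\tr (X *m (1%:M - T))).

(* test-measured Renyi divergence (max over tests, written as a sup) *)
Definition Dtest (d : nat) (alpha : R) (rho sigma : 'M[C]_d) : \bar R :=
  ereal_sup [set crenyi alpha (testdist T rho) (testdist T sigma)
            | T in [set T : 'M[C]_d | testmx T]].

(* n-fold tensor power *)
Definition tpow (d : nat) (A : 'M[C]_d) (n : nat) : 'M[C]_(d ^ n) :=
  ntensmx A n.

(* the sequence (1/n) D_alpha^test(rho^{(x)n} || sigma^{(x)n}) *)
Definition Dtest_seq (d : nat) (alpha : R) (rho sigma : 'M[C]_d) (n : nat)
  : \bar R :=
  (((n%:R)^-1)%:E * Dtest alpha (tpow rho n) (tpow sigma n))%E.

(* regularised test-measured Renyi divergence (limsup) *)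
Definition Dtest_reg (d : nat) (alpha : R) (rho sigma : 'M[C]_d) : \bar R :=
  limn_esup (Dtest_seq alpha rho sigma).

(* Petz-type Renyi divergence, +oo when the trace vanishes *)
Definition petz (d : nat) (alpha : R) (rho sigma : 'M[C]_d) : \bar R :=
  let s := complex.Re (\tr (mxpowR rho alpha *m mxpowR sigma (1 - alpha))) in
  if s == 0 then +oo%E else ((alpha - 1)^-1 * ln s)%:E.

(* Hoeffding divergence *)
Definition hoeffding (d : nat) (rho sigma : 'M[C]_d) (r : R) : \bar R :=
  ereal_sup [set (((beta - 1) / beta)%:E * (r%:E - petz beta rho sigma))%E
            | beta in [set beta : R | 0 < beta < 1]].

End QDefs.

(* Main.v *)
(** Diagonalise [rho = sum_i a_i |i><i|], [sigma = sum_j b_j |j><j|] and put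
    [K_ij = |<i|j>|^2], so that [F beta = sum_ij K_ij a_i^beta b_j^(1 - beta)] is
    [Tr rho^beta sigma^(1 - beta)].  Eliminating [r] from [r <= alpha / (1 - alpha) H_r],
    both suprema equal the supremum of the reals [x] such that
    [F beta <= exp (- x (1 - beta + beta (1 - alpha) / alpha))] for some [beta].

    Achievability: the inequality of Audenaert et al. (proved as Ozawa does, from
    Loewner-Heinz monotonicity of [t^s]) applied to multiples of the tensor powers of
    [rho] and [sigma] gives tests whose error probabilities are at most
    [exp (- n x (1 - alpha) / alpha)] and [exp (- n x)].

    Converse: by Nussbaum and Szkola the weighted error sum of any test is at least half
    of the i.i.d. sum [sum K^n min(X a^n, Y b^n)]; exponential tilting at the minimiser
    of the Chernoff function and a second moment estimate bound the latter from below.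
    A test violating the claimed exponent, or its complement, has both error
    probabilities small, which contradicts this bound. *)
Require Import Defs.
From HB Require Import structures.
From mathcomp Require Import all_boot all_order all_algebra.
From mathcomp Require Import complex mxtens.
From mathcomp Require Import all_classical all_reals all_analysis.
From mathcomp Require Import ring lra.
Set Implicit Arguments.
Unset Strict Implicit.
Unset Printing Implicit Defensive.
Import Order.TTheory GRing.Theory Num.Theory.
Import numFieldNormedType.Exports.
Local Open Scope ring_scope.
Local Open Scope complex_scope.
Local Open Scope sesquilinear_scope.
Local Open Scope classical_set_scope.

(** * Chernoff lower bound for i.i.d. sums *)

Section WeightedWalk.
Variables (R : realType) (I : finType) (P : pred I) (w x : I -> R).

(** Expectation of [f] at the endpoint of an [n]-step random walk with independent steps [x i] of
    weight [w i]; recursion on the first step avoids sums over words. *)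
Fixpoint walk_mean (n : nat) (f : R -> R) : R :=
  if n is n'.+1 then \sum_(i | P i) w i * walk_mean n' (fun y => f (x i + y))
  else f 0.

Lemma walk_mean_le n f g : (forall i, P i -> 0 <= w i) ->
  (forall y, f y <= g y) -> walk_mean n f <= walk_mean n g.
Proof.
move=> w0; elim: n f g => [|n IH] f g fg /=; first exact: fg.
by apply: ler_sum => i Pi; apply: ler_wpM2l; [exact: w0|apply: IH].
Qed.

Hypothesis w1 : \sum_(i | P i) w i = 1.

Lemma walk_mean_affine n a b f :
  walk_mean n (fun y => a + b * f y) = a + b * walk_mean n f.
Proof.
elim: n f => [|n IH] f //=.
under eq_bigr => i _ do rewrite IH mulrDr mulrCA.
by rewrite big_split /= -mulr_suml w1 mul1r -mulr_sumr.
Qed.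

Let m := \sum_(i | P i) w i * x i.
Let V := \sum_(i | P i) w i * (x i - m) ^+ 2.

(** Variance plus squared mean: independent steps of mean [m] and variance [V] add up both. The
    offset [c] carries the steps already made in the induction. *)
Lemma walk_mean_sqr n c :
  walk_mean n (fun y => (c + y) ^+ 2) = n%:R * V + (c + n%:R * m) ^+ 2.
Proof.
elim: n c => [|n IH] c /=; first by rewrite !mul0r !addr0 add0r.
under eq_bigr => i _.
  rewrite (_ : (fun y => _) = (fun y => ((c + x i) + y) ^+ 2)); last first.
    by apply: funext => y; rewrite addrA.
  rewrite IH.
  (* The square is expanded around [x i = m]; the linear terms cancel after summation because [m] is
     the mean. *)
  rewrite (_ : w i * _ = (n%:R * V + (c + n.+1%:R * m) ^+ 2) * w i
      + w i * (x i - m) ^+ 2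
      + (2 * (c + n.+1%:R * m)) * (w i * x i)
      - (2 * (c + n.+1%:R * m) * m) * w i); last first.
    by rewrite -natr1; ring.
  over.
rewrite sumrB !big_split /= -!mulr_sumr w1 -/m -/V -natr1; ring.
Qed.

(** In substance Jensen: the mean absolute deviation is at most the standard deviation, hence at
    most [s]. A single quadratic minorant replaces both inequalities, so only the second moment
    enters. *)
Lemma walk_mean_expR_norm n (s : R) : (forall i, P i -> 0 <= w i) ->
  0 < s -> n%:R * V <= s ^+ 2 ->
  expR (- s) <= walk_mean n (fun y => expR (- `|y - n%:R * m|)).
Proof.
move=> w0 s0 Vs.
(* tangent line of [exp] at [- s], then AM-GM [|z| <= (z^2 / s + s) / 2] *)
pose g y := expR (- s) * (1 + s / 2)
  + (- (expR (- s) / (2 * s))) * (- (n%:R * m) + y) ^+ 2.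
apply: (@le_trans _ _ (walk_mean n g)).
  rewrite walk_mean_affine walk_mean_sqr addNr expr0n /= addr0.
  have -> : expR (- s) * (1 + s / 2) + - (expR (- s) / (2 * s)) * (n%:R * V)
     = expR (- s) + expR (- s) / (2 * s) * (s ^+ 2 - n%:R * V).
    by field; rewrite gt_eqF.
  rewrite lerDl mulr_ge0 ?subr_ge0// divr_ge0 ?expR_ge0//.
  by rewrite mulr_ge0 ?ltW.
apply: walk_mean_le => // y; rewrite /g [- _ + y]addrC.
set z := y - n%:R * m.
have -> : - `|z| = - s + (s - `|z|) by ring.
rewrite expRD.
have -> : expR (- s) * (1 + s / 2) + - (expR (- s) / (2 * s)) * z ^+ 2
  = expR (- s) * (1 + s / 2 - z ^+ 2 / (2 * s)) by field; rewrite gt_eqF.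
rewrite ler_pM2l ?expR_gt0//.
apply: le_trans (expR_ge1Dx _).
rewrite -addrA lerD2l -subr_ge0 -[z ^+ 2]real_normK ?num_real//.
have -> : s - `|z| - (s / 2 - `|z| ^+ 2 / (2 * s)) = (s - `|z|) ^+ 2 / (2 * s).
  by field; rewrite gt_eqF.
by rewrite divr_ge0 ?sqr_ge0// mulr_ge0 ?ltW.
Qed.

End WeightedWalk.

(** * Exponential tilting at the minimiser of the Chernoff function *)

Section Chernoff.
Variables (R : realType) (I : finType) (k l m : I -> R).

(* The sum of [k^n(w) g (l^n(w)) (m^n(w))] over [w : I^n]. *)
Fixpoint iidsum (n : nat) (g : R -> R -> R) : R :=
  if n is n'.+1 then
    \sum_i k i * iidsum n' (fun a b => g (l i * a) (m i * b))
  else g 1 1.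

Definition common_supp : pred I := fun i => (0 < l i) && (0 < m i).

(** The sum of [k l^b m^(1-b)], written with [expR] and [ln] on the common support so that it stays
    continuous at [b = 0] and [b = 1], where the convention 0^0 = 1 would produce jumps. *)
Definition chernoff_sum (b : R) : R :=
  \sum_(i | common_supp i) k i * expR (b * ln (l i) + (1 - b) * ln (m i)).

Definition llr (i : I) : R := ln (l i) - ln (m i).

(** The derivative of [chernoff_sum] in [b]; divided by [chernoff_sum b] it is the mean of [llr]
    under the tilted law. *)
Definition chernoff_slope (b : R) : R :=
  \sum_(i | common_supp i)
    k i * expR (b * ln (l i) + (1 - b) * ln (m i)) * llr i.

Hypothesis k0 : forall i, 0 <= k i.
Hypothesis l0 : forall i, 0 <= l i.
Hypothesis m0 : forall i, 0 <= m i.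

Lemma iidsum_ge0 n g : (forall a b, 0 <= a -> 0 <= b -> 0 <= g a b) ->
  0 <= iidsum n g.
Proof.
elim: n g => [|n IH] g g0 /=; first exact: g0.
apply: sumr_ge0 => i _; apply: mulr_ge0 => //; apply: IH => a b a0 b0.
by apply: g0; rewrite mulr_ge0.
Qed.

Definition tilt (b : R) (i : I) : R :=
  k i * expR (b * ln (l i) + (1 - b) * ln (m i)) / chernoff_sum b.

Lemma tilt_sum1 b : chernoff_sum b != 0 -> \sum_(i | common_supp i) tilt b i = 1.
Proof. by move=> F0; rewrite -mulr_suml divff. Qed.

(** Change of measure: min(p, q) is p^be q^(1-be) times the minimum of (p/q)^(1-be) and (p/q)^(-be).
    The first factor is multiplicative over letters and is absorbed into the tilted law; [a] and [b]
    accumulate the logarithms of the letters already read. *)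
Lemma iidsum_min_tilt n (be a b : R) : 0 < chernoff_sum be ->
  expR (be * a + (1 - be) * b) * chernoff_sum be ^+ n *
    walk_mean common_supp (tilt be) llr n
     (fun y => Num.min (expR ((1 - be) * ((a - b) + y)))
                       (expR (- be * ((a - b) + y))))
  <= iidsum n (fun u v => Num.min (expR a * u) (expR b * v)).
Proof.
move=> F0; elim: n a b => [|n IH] a b /=.
  rewrite expr0 !mulr1 addr0 minr_pMr ?expR_ge0// -!expRD.
  rewrite (_ : _ + (1 - be) * (a - b) = a); last by ring.
  by rewrite (_ : _ + - be * (a - b) = b) //; ring.
rewrite [leRHS](bigID common_supp) /=; apply: ler_wpDr.
  apply: sumr_ge0 => i _; apply: mulr_ge0 => //; apply: iidsum_ge0 => u v u0 v0.
  by rewrite le_min !mulr_ge0 ?expR_ge0.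
rewrite mulr_sumr; apply: ler_sum => i /andP[li mi].
have /(ler_wpM2l (k0 i)) := IH (a + ln (l i)) (b + ln (m i)).
set A := walk_mean _ _ _ _ _; set B := walk_mean _ _ _ _ _.
have -> : A = B.
  rewrite /A /B; congr walk_mean; apply: funext => y.
  rewrite (_ : a + _ - _ + y = a - b + (llr i + y)) // /llr; ring.
set J := iidsum _ _; set J' := iidsum _ _.
have -> : J = J'.
  rewrite /J /J'; congr iidsum; apply: funext => u; apply: funext => v.
  by rewrite !expRD !lnK ?posrE// !mulrA.
apply: le_trans; rewrite exprSr /tilt.
rewrite (_ : be * (a + _) + _ =
  (be * a + (1 - be) * b) + (be * ln (l i) + (1 - be) * ln (m i))); last by ring.
rewrite (expRD (be * a + _)) le_eqVlt; apply/orP; left; apply/eqP.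
by field; rewrite gt_eqF.
Qed.

Lemma chernoff_slopeE b : chernoff_sum b != 0 ->
  \sum_(i | common_supp i) tilt b i * llr i = chernoff_slope b / chernoff_sum b.
Proof.
by move=> F0; rewrite mulr_suml; apply: eq_bigr => i _; rewrite mulrAC.
Qed.

Lemma continuous_sumR (J : finType) (Q : pred J) (f : J -> R -> R) :
  (forall i, Q i -> continuous (f i)) ->
  continuous (fun b => \sum_(i | Q i) f i b).
Proof.
move=> fc; apply: continuous_big => //; first exact: add_continuous.
Qed.

Lemma continuous_chernoff_term c u v :
  continuous (fun b : R => c * expR (b * u + (1 - b) * v)).
Proof.
move=> b; apply: cvgMl_tmp; apply: continuous_comp; last exact: continuous_expR.
by apply: cvgD; apply: cvgMr_tmp => //; apply: cvgB => //; exact: cvg_cst.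
Qed.

Lemma continuous_chernoff_slope : continuous chernoff_slope.
Proof.
apply: continuous_sumR => i _ b; apply: cvgMr_tmp.
exact: continuous_chernoff_term.
Qed.

Lemma continuous_chernoff_sum : continuous chernoff_sum.
Proof. by apply: continuous_sumR => i _; exact: continuous_chernoff_term. Qed.

(* The minimiser of the convex function [chernoff_sum] on [0, 1]. *)
Lemma chernoff_tilt_exists : exists2 b, 0 <= b <= 1 &
  [\/ chernoff_slope b = 0, b = 0 /\ 0 <= chernoff_slope b
    | b = 1 /\ chernoff_slope b <= 0].
Proof.
have [h0|h0] := leP 0 (chernoff_slope 0).
  by exists 0; rewrite ?lexx ?ler01//; apply: Or32.
have [h1|h1] := leP (chernoff_slope 1) 0.
  by exists 1; rewrite ?lexx ?ler01//; apply: Or33.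
have [|||c] := @IVT R chernoff_slope 0 1 0 => //.
- by apply: continuous_subspaceT; exact: continuous_chernoff_slope.
- by rewrite ge_min le_max (ltW h0) (ltW h1) orbT.
by rewrite in_itv /= => c01 c0; exists c => //; apply: Or31.
Qed.

(** [V] is the variance of [llr] under the law tilted at the minimiser. Taking [s] of order sqrt n
    costs only a subexponential factor. *)
Lemma iidsum_min_chernoff (delta : R) :
  (forall b, 0 <= b <= 1 -> expR delta <= chernoff_sum b) ->
  exists2 V, 0 <= V & forall n (s : R), 0 < s -> n%:R * V <= s ^+ 2 ->
    expR (n%:R * delta - s) <= iidsum n Num.min.
Proof.
move=> Fd; have [b b01 hb] := chernoff_tilt_exists.
have F0 : 0 < chernoff_sum b by apply: lt_le_trans (Fd _ b01); exact: expR_gt0.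
have F0' : chernoff_sum b != 0 by rewrite gt_eqF.
pose mu := \sum_(i | common_supp i) tilt b i * llr i.
have w0 i : common_supp i -> 0 <= tilt b i.
  by move=> _; apply: divr_ge0; [rewrite mulr_ge0 ?expR_ge0|exact: ltW].
exists (\sum_(i | common_supp i) tilt b i * (llr i - mu) ^+ 2).
  by apply: sumr_ge0 => i Pi; rewrite mulr_ge0 ?sqr_ge0 ?w0.
move=> n s s0 sV.
have := iidsum_min_tilt n 0 0 F0.
rewrite !mulr0 addr0 expR0 mul1r.
have -> : (fun u v : R => Num.min (1 * u) (1 * v)) = Num.min.
  by apply: funext => u; apply: funext => v; rewrite !mul1r.
apply: le_trans; rewrite expRD.
apply: ler_pM; rewrite ?expR_ge0//.
  rewrite expRM_natl; apply: lerXn2r; rewrite ?nnegrE ?expR_ge0 ?(ltW F0)//.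
  exact: Fd.
apply: le_trans (walk_mean_expR_norm (tilt_sum1 F0') w0 s0 sV) _.
apply: walk_mean_le => // y; rewrite -/mu subrr add0r le_min !ler_expR.
set z := n%:R * mu; have le_n := ler_norm (y - z).
have ge_n : - (y - z) <= `|y - z| by rewrite -normrN ler_norm.
have slopeE : mu = chernoff_slope b / chernoff_sum b by exact: chernoff_slopeE.
have [b0 b1] := andP b01.
(* At an interior minimiser the drift [z] vanishes. At [b = 0] it is nonnegative and the nonconstant
   exponent is y; at [b = 1] it is nonpositive and that exponent is -y. Each time both exponents are
   at least -|y - z|. *)
case: hb => [h|[b_eq h]|[b_eq h]].
- have z0 : z = 0 by rewrite /z slopeE h mul0r mulr0.
  by move: le_n ge_n; rewrite z0 subr0 => le_n ge_n; apply/andP; split; nra.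
- have z0 : 0 <= z by rewrite /z slopeE mulr_ge0// divr_ge0// ltW.
  by rewrite b_eq; apply/andP; split; nra.
- have z0 : z <= 0.
    apply: mulr_ge0_le0 => //; rewrite slopeE; apply: mulr_le0_ge0 => //.
    by rewrite invr_ge0 ltW.
  by rewrite b_eq; apply/andP; split; nra.
Qed.
End Chernoff.

(** * Spectral decompositions of positive semidefinite matrices *)

Section Adjoint.
Variable C : numClosedFieldType.

Lemma adjmxM m n p (A : 'M[C]_(m, n)) (B : 'M[C]_(n, p)) :
  (A *m B)^t* = B^t* *m A^t*.
Proof. by rewrite trmx_mul map_mxM. Qed.

Lemma adjmxD m n (A B : 'M[C]_(m, n)) : (A + B)^t* = A^t* + B^t*.
Proof. by rewrite linearD /= map_mxD. Qed.

Lemma adjmxB m n (A B : 'M[C]_(m, n)) : (A - B)^t* = A^t* - B^t*.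
Proof. by rewrite linearB /= map_mxB. Qed.

Lemma adjmxE m n (A : 'M[C]_(m, n)) i j : A^t* i j = Num.conj (A j i).
Proof. by rewrite !mxE. Qed.

Lemma adjmx1 n : (1%:M : 'M[C]_n)^t* = 1%:M.
Proof. by rewrite trmx1 map_mx1. Qed.

Lemma unitarymxVK n (U : 'M[C]_n) : U \is unitarymx -> U^t* *m U = 1%:M.
Proof. by move=> /unitarymxP /mulmx1C. Qed.
End Adjoint.

Section PSD.
Variable R : realType.
Local Notation C := (R[i]).

Lemma psdmx_conj m n (K : 'M[C]_(m, n)) (X : 'M[C]_n) :
  psdmx X -> psdmx (K *m X *m K^t*).
Proof.
move=> [Xh X0]; split; first by rewrite !adjmxM trmxCK -Xh mulmxA.
by move=> v; have := X0 (v *m K); rewrite adjmxM !mulmxA.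
Qed.

Lemma psdmxD n (X Y : 'M[C]_n) : psdmx X -> psdmx Y -> psdmx (X + Y).
Proof.
move=> [Xh X0] [Yh Y0]; split; first by rewrite adjmxD -Xh -Yh.
by move=> v; rewrite mulmxDr mulmxDl mxE addr_ge0.
Qed.

Lemma psdmx_diag_ge0 n (X : 'M[C]_n) i : psdmx X -> 0 <= X i i.
Proof.
move=> [_ /(_ (delta_mx 0 i))].
rewrite -rowE [_^t*](_ : _ = delta_mx i 0) ?mulmx_delta; last first.
  by apply/matrixP => a b; rewrite !mxE andbC rmorph_nat.
by rewrite -colE !mxE.
Qed.

Lemma psdmx_tr_ge0 n (X : 'M[C]_n) : psdmx X -> 0 <= \tr X.
Proof. by move=> X0; apply: sumr_ge0 => i _; exact: psdmx_diag_ge0. Qed.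

(* The eigenvectors are the rows of [U]. *)
Fact sdiag_key : unit. Proof. by []. Qed.
Definition sdiag n (U : 'M[C]_n) (a : 'I_n -> R) : 'M[C]_n :=
  locked_with sdiag_key (U^t* *m diag_mx (\row_j (a j)%:C) *m U).

Lemma sdiagE n (U : 'M[C]_n) a :
  sdiag U a = U^t* *m diag_mx (\row_j (a j)%:C) *m U.
Proof. by rewrite /sdiag unlock. Qed.

Lemma eq_sdiag n (U : 'M[C]_n) a b : a =1 b -> sdiag U a = sdiag U b.
Proof. by move=> /funext ->. Qed.

Lemma diagC_adj n (a : 'I_n -> R) :
  (diag_mx (\row_j (a j)%:C))^t* = diag_mx (\row_j (a j)%:C) :> 'M[C]_n.
Proof.
rewrite tr_diag_mx map_diag_mx; congr diag_mx.
by apply/rowP => j; rewrite !mxE; apply: conj_Creal; apply/complex_realP; exists (a j).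
Qed.

Lemma sdiag_adj n (U : 'M[C]_n) a : (sdiag U a)^t* = sdiag U a.
Proof. by rewrite !sdiagE !adjmxM trmxCK diagC_adj mulmxA. Qed.

Lemma diagC_psd n (a : 'I_n -> R) : (forall j, 0 <= a j) ->
  psdmx (diag_mx (\row_j (a j)%:C) : 'M[C]_n).
Proof.
move=> a0; split; first by rewrite diagC_adj.
move=> v; rewrite mul_mx_diag mxE; apply: sumr_ge0 => j _.
by rewrite !mxE mulrAC mulr_ge0 ?mul_conjC_ge0// lecR.
Qed.

Lemma sdiag_psd n (U : 'M[C]_n) a : (forall j, 0 <= a j) -> psdmx (sdiag U a).
Proof.
move=> a0; have := psdmx_conj (U^t*) (diagC_psd a0).
by rewrite trmxCK sdiagE.
Qed.

Lemma sdiagM n (U : 'M[C]_n) a b : U \is unitarymx ->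
  sdiag U a *m sdiag U b = sdiag U (fun j => a j * b j).
Proof.
move=> Uu; have DD : diag_mx (\row_j (a j)%:C) *m diag_mx (\row_j (b j)%:C)
    = diag_mx (\row_j (a j * b j)%:C) :> 'M[C]_n.
  rewrite mulmx_diag; congr diag_mx.
  by apply/rowP => j; rewrite !mxE -rmorphM.
rewrite !sdiagE -DD; move: (diag_mx _) (diag_mx _) => D D'.
by rewrite -!mulmxA (mulmxA U (U^t*)) (unitarymxP Uu) mul1mx.
Qed.

Lemma sdiag1 n (U : 'M[C]_n) : U \is unitarymx -> sdiag U (fun=> 1) = 1%:M.
Proof.
move=> Uu; rewrite !sdiagE (_ : diag_mx _ = 1%:M) ?mulmx1 ?unitarymxVK//.
by apply/matrixP => i j; rewrite !mxE.
Qed.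

Lemma sdiagB n (U : 'M[C]_n) a b :
  sdiag U a - sdiag U b = sdiag U (fun j => a j - b j).
Proof.
have E : diag_mx (\row_j (a j)%:C) - diag_mx (\row_j (b j)%:C)
    = diag_mx (\row_j (a j - b j)%:C) :> 'M[C]_n.
  by apply/matrixP => i j; rewrite !mxE -mulrnBl -rmorphB.
by rewrite !sdiagE -E mulmxBr mulmxBl.
Qed.

Lemma sdiagD n (U : 'M[C]_n) a b :
  sdiag U a + sdiag U b = sdiag U (fun j => a j + b j).
Proof.
have E : diag_mx (\row_j (a j)%:C) + diag_mx (\row_j (b j)%:C)
    = diag_mx (\row_j (a j + b j)%:C) :> 'M[C]_n.
  by apply/matrixP => i j; rewrite !mxE -mulrnDl -rmorphD.
by rewrite !sdiagE -E mulmxDr mulmxDl.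
Qed.

Lemma sdiag_tr n (U : 'M[C]_n) a X :
  \tr (sdiag U a *m X) = \sum_j (a j)%:C * (U *m X *m U^t*) j j.
Proof.
have -> : \tr (sdiag U a *m X)
    = \tr (diag_mx (\row_j (a j)%:C) *m (U *m X *m U^t*)).
  by rewrite !sdiagE -!mulmxA mxtrace_mulC !mulmxA.
by apply: eq_bigr => j _; rewrite mul_diag_mx !mxE.
Qed.

Definition eigR n (A : 'M[C]_n) (j : 'I_n) : R := complex.Re (spectral_diag A 0 j).

Lemma hermitian_sdiag n (A : 'M[C]_n) : A = A^t* -> A = sdiag (spectralmx A) (eigR A).
Proof.
move=> Ah; have Ahs : A \is hermsymmx by apply/is_hermitianmxP; rewrite expr0 scale1r.
have /orthomx_spectralP := hermitian_normalmx Ahs.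
rewrite invmx_unitary ?spectral_unitarymx// => {1}->.
rewrite sdiagE; congr (_ *m _); congr (_ *m diag_mx _); apply/rowP => j; rewrite !mxE.
by have /mxOverP/(_ 0 j) := hermitian_spectral_diag_real Ahs; move=> h; rewrite /eigR RRe_real.
Qed.

Lemma sdiag_unconj n (U : 'M[C]_n) a : U \is unitarymx ->
  U *m sdiag U a *m U^t* = diag_mx (\row_j (a j)%:C).
Proof.
move=> Uu; rewrite !sdiagE !mulmxA (unitarymxP Uu) mul1mx -mulmxA.
by rewrite (unitarymxP Uu) mulmx1.
Qed.

Lemma psd_sdiag_ge0 n (U : 'M[C]_n) a : U \is unitarymx ->
  psdmx (sdiag U a) -> forall j, 0 <= a j.
Proof.
move=> Uu /(psdmx_conj U); rewrite sdiag_unconj// => /psdmx_diag_ge0 + j.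
by move=> /(_ j); rewrite !mxE eqxx mulr1n lecR.
Qed.

Lemma psd_eigR_ge0 n (A : 'M[C]_n) : psdmx A -> forall j, 0 <= eigR A j.
Proof.
move=> A0; apply: (psd_sdiag_ge0 (spectral_unitarymx A)).
by rewrite -hermitian_sdiag//; case: A0.
Qed.

Lemma psd_trM_ge0 n (X Y : 'M[C]_n) : psdmx X -> psdmx Y -> 0 <= \tr (X *m Y).
Proof.
move=> X0 Y0; rewrite (hermitian_sdiag (proj1 X0)) sdiag_tr.
apply: sumr_ge0 => j _; rewrite mulr_ge0 ?lecR ?psd_eigR_ge0//.
by apply: psdmx_diag_ge0; exact: psdmx_conj.
Qed.

(** Squared modulus of the inner product of row [i] of [U] with row [j] of [V], as a real number:
    the Nussbaum-Szkola weight. *)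
Definition overlap n (U V : 'M[C]_n) i j : R :=
  complex.Re ((U *m V^t*) i j) ^+ 2 + complex.Im ((U *m V^t*) i j) ^+ 2.

Lemma mulCconj (z : C) : z * Num.conj z = (complex.Re z ^+ 2 + complex.Im z ^+ 2)%:C.
Proof. by case: z => a b; simpc; rewrite !expr2; congr (_ +i* _); ring. Qed.

Lemma overlap_ge0 n (U V : 'M[C]_n) i j : 0 <= overlap U V i j.
Proof. by rewrite addr_ge0 ?sqr_ge0. Qed.

Lemma sdiag_trM n (U V : 'M[C]_n) a b :
  \tr (sdiag U a *m sdiag V b)
  = (\sum_i \sum_j overlap U V i j * (a i * b j))%:C.
Proof.
rewrite sdiag_tr rmorph_sum; apply: eq_bigr => i _ /=.
rewrite (_ : U *m _ *m _ =
   (U *m V^t*) *m diag_mx (\row_j (b j)%:C) *m (U *m V^t*)^t*); last first.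
  by rewrite adjmxM trmxCK sdiagE !mulmxA.
rewrite mul_mx_diag mxE rmorph_sum mulr_sumr; apply: eq_bigr => j _ /=.
rewrite adjmxE mxE mxE /overlap !rmorphM /= -mulCconj; ring.
Qed.

End PSD.

(** * Errors of a quantum test *)

Section TestError.
Variable R : realType.
Local Notation C := (R[i]).

Lemma Re_ge0 (z : C) : 0 <= z -> 0 <= complex.Re z.
Proof. by case: z => a b; rewrite lecE /= => /andP[]. Qed.

Lemma Re_rmul (a : R) (z : C) : complex.Re (a%:C * z) = a * complex.Re z.
Proof. by case: z => x y /=; rewrite mul0r subr0. Qed.

Lemma testmx_compl n (T : 'M[C]_n) : testmx T -> testmx (1%:M - T).
Proof. by move=> [T0 S0]; split; [exact: S0|rewrite opprB addrC subrK; exact: T0]. Qed.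

(** T - T^2 = T(I - T)T + (I - T)T(I - T), a sum of congruences of positive operators. *)
Lemma testmx_sqr n (T : 'M[C]_n) : testmx T -> psdmx (T - T *m T).
Proof.
move=> [T0 S0]; have Th := proj1 T0; have Sh := proj1 S0.
have -> : T - T *m T = T *m (1%:M - T) *m T^t*
    + (1%:M - T) *m T *m (1%:M - T)^t*.
  rewrite -Th -Sh !(mulmxBl, mulmxBr, mul1mx, mulmx1).
  by rewrite [RHS]addrC subrK.
by apply: psdmxD; apply: psdmx_conj.
Qed.

(** Since [V] is unitary, the left side is the diagonal entry of U K^2 U^*, and K^2 <= K for a
    test. *)
Lemma testmx_diag_lb n (U V K : 'M[C]_n) i :
  V \is unitarymx -> testmx K ->
  \sum_j (complex.Re ((U *m K *m V^t*) i j) ^+ 2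
          + complex.Im ((U *m K *m V^t*) i j) ^+ 2)
  <= complex.Re ((U *m K *m U^t*) i i).
Proof.
move=> Vu TK; have E : ((U *m (K *m K)) *m U^t*) i i =
  (\sum_j (complex.Re ((U *m K *m V^t*) i j) ^+ 2
          + complex.Im ((U *m K *m V^t*) i j) ^+ 2))%:C.
  have -> : (U *m (K *m K)) *m U^t* = (U *m K *m V^t*) *m (U *m K *m V^t*)^t*.
    rewrite !adjmxM trmxCK -(proj1 (proj1 TK)) !mulmxA.
    by rewrite -(mulmxA _ (V^t*) V) (unitarymxVK Vu) mulmx1.
  rewrite mxE rmorph_sum; apply: eq_bigr => j _.
  by rewrite adjmxE mulCconj.
rewrite -subr_ge0; have /Re_ge0 := psdmx_diag_ge0 i (psdmx_conj U (testmx_sqr TK)).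
by rewrite mulmxBr mulmxBl mxE [X in _ + X]mxE E raddfB.
Qed.

(* Nussbaum and Szkola's comparison with the classical minimal error. *)
Lemma test_error_lb n (U V T : 'M[C]_n) a b :
  U \is unitarymx -> V \is unitarymx -> (forall i, 0 <= a i) ->
  (forall j, 0 <= b j) -> testmx T ->
  \sum_i \sum_j overlap U V i j * Num.min (a i) (b j)
  <= 2 * (complex.Re (\tr (sdiag U a *m (1%:M - T)))
          + complex.Re (\tr (sdiag V b *m T))).
Proof.
move=> Uu Vu a0 b0 TT.
pose sq (z : C) := complex.Re z ^+ 2 + complex.Im z ^+ 2.
pose M1 := U *m (1%:M - T) *m V^t*; pose M2 := U *m T *m V^t*.
have sq0 z : 0 <= sq z by rewrite addr_ge0 ?sqr_ge0.
have E1 : \sum_i \sum_j a i * sq (M1 i j)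
    <= complex.Re (\tr (sdiag U a *m (1%:M - T))).
  rewrite sdiag_tr raddf_sum; apply: ler_sum => i _ /=.
  rewrite Re_rmul -mulr_sumr ler_wpM2l//.
  exact/testmx_diag_lb/testmx_compl.
have E2 : \sum_i \sum_j b j * sq (M2 i j) <= complex.Re (\tr (sdiag V b *m T)).
  rewrite exchange_big sdiag_tr raddf_sum; apply: ler_sum => j _ /=.
  rewrite Re_rmul -mulr_sumr ler_wpM2l//.
  apply: le_trans (testmx_diag_lb V j Uu TT).
  apply: ler_sum => i _; rewrite /sq.
  have -> : V *m T *m U^t* = M2^t*.
    by rewrite /M2 !adjmxM trmxCK -(proj1 (proj1 TT)) mulmxA.
  by rewrite adjmxE; case: (M2 i j) => x y /=; rewrite sqrrN.
apply: (le_trans _ (ler_wpM2l _ (lerD E1 E2))) => //.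
rewrite -big_split /= mulr_sumr; apply: ler_sum => i _.
rewrite -big_split /= mulr_sumr; apply: ler_sum => j _.
(* Inserting I = (I - T) + T splits the amplitude in two; the factor 2 comes from |u + v|^2 <=
   2(|u|^2 + |v|^2). *)
have -> : overlap U V i j = sq (M1 i j + M2 i j).
  rewrite /overlap -/(sq _); congr (sq _).
  by rewrite /M1 /M2 mulmxBr mulmx1 mulmxBl !mxE subrK.
have : sq (M1 i j + M2 i j) <= 2 * (sq (M1 i j) + sq (M2 i j)).
  rewrite /sq; case: (M1 i j) => x y; case: (M2 i j) => z t /=.
  rewrite -subr_ge0.
  rewrite (_ : _ - _ = (x - z) ^+ 2 + (y - t) ^+ 2); last by ring.
  by rewrite addr_ge0 ?sqr_ge0.
set p := sq (M1 i j); set q := sq (M2 i j) => h.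
have p0 : 0 <= p by exact: sq0. have q0 : 0 <= q by exact: sq0.
apply: (le_trans (ler_wpM2r _ h)); first by rewrite le_min a0 b0.
rewrite -mulrA ler_wpM2l// mulrDl; apply: lerD.
  by rewrite mulrC ler_wpM2r// ge_min lexx.
by rewrite mulrC ler_wpM2r// ge_min lexx orbT.
Qed.
End TestError.

(** * Operator monotonicity of powers *)

Section LownerHeinz.
Variable R : realType.
Local Notation C := (R[i]).

Lemma powR_ge0D (x r s : R) : 0 <= r -> 0 <= s -> x `^ (r + s) = x `^ r * x `^ s.
Proof.
move=> r0 s0; have [rs0|rs0] := eqVneq (r + s) 0; last first.
  by rewrite powRD// (negbTE rs0).
by move/eqP: rs0; rewrite paddr_eq0// => /andP[/eqP-> /eqP->]; rewrite addr0 !powRr0 mulr1.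
Qed.

(** Here the power 0 is the identity, not the support projection as for [mxpowR]; this makes
    exponents add up to and including 0. *)
Definition spow n (U : 'M[C]_n) (x : 'I_n -> R) (r : R) :=
  locked_with sdiag_key (sdiag U (fun j => x j `^ r)).

Lemma spowE n (U : 'M[C]_n) x r : spow U x r = sdiag U (fun j => x j `^ r).
Proof. by rewrite /spow unlock. Qed.

Lemma spow_ge0D n (U : 'M[C]_n) x r s : U \is unitarymx ->
  0 <= r -> 0 <= s -> spow U x r *m spow U x s = spow U x (r + s).
Proof.
move=> Uu r0 s0; rewrite !spowE (sdiagM _ _ Uu); apply: eq_sdiag => j.
by rewrite powR_ge0D.
Qed.

Lemma spow_gt0D n (U : 'M[C]_n) x r s : U \is unitarymx ->
  (forall j, 0 < x j) -> spow U x r *m spow U x s = spow U x (r + s).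
Proof.
move=> Uu x0; rewrite !spowE (sdiagM _ _ Uu); apply: eq_sdiag => j.
by rewrite powRD// (gt_eqF (x0 j)) implybT.
Qed.

Lemma spow0 n (U : 'M[C]_n) x : U \is unitarymx -> spow U x 0 = 1%:M.
Proof.
move=> Uu; rewrite -(sdiag1 Uu) spowE; apply: eq_sdiag => j.
by rewrite powRr0.
Qed.

Lemma spow1 n (U : 'M[C]_n) x : (forall j, 0 <= x j) -> spow U x 1 = sdiag U x.
Proof.
move=> x0; rewrite spowE; apply: eq_sdiag => j.
by rewrite powRr1.
Qed.

Lemma mulmx_adj_ge0 n (w : 'rV[C]_n) : 0 <= (w *m w^t*) 0 0.
Proof. by rewrite mxE sumr_ge0// => j _; rewrite adjmxE mul_conjC_ge0. Qed.

Lemma mulmx_adj_eq0 n (w : 'rV[C]_n) : (w *m w^t*) 0 0 = 0 -> w = 0.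
Proof. by rewrite -dotmxE => /eqP; rewrite dnorm_eq0 => /eqP. Qed.

Lemma spow_adj n (U : 'M[C]_n) x r : (spow U x r)^t* = spow U x r.
Proof. by rewrite spowE sdiag_adj. Qed.

(** [Yi] plays the inverse square root of [Ys] and [Xh] the square root of [Xs]: from Xs <= Ys one
    gets Yi Xs Yi <= I, so [Yi *m Xh] is a contraction. *)
Lemma contraction_le n (Yi Ys Xs Xh : 'M[C]_n) (w : 'rV[C]_n) :
  Yi^t* = Yi -> Xh^t* = Xh -> Yi *m Ys *m Yi = 1%:M -> Xh *m Xh = Xs ->
  psdmx (Ys - Xs) ->
  ((w *m Yi *m Xh) *m (w *m Yi *m Xh)^t*) 0 0 <= (w *m w^t*) 0 0.
Proof.
move=> Yh Xhh Y1 <- [_ /(_ (w *m Yi))].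
rewrite mulmxBr mulmxBl mxE [X in _ + X]mxE subr_ge0 !adjmxM Yh Xhh.
rewrite !mulmxA => /le_trans; apply.
by rewrite -(mulmxA w) -(mulmxA w) Y1 mulmx1.
Qed.

(* Pedersen's argument: [Yui *m Xu *m Yui] is Hermitian and similar to the product
   of the contractions [Ysi *m Xs] and [Xt *m Yti], so its eigenvalues are at most [1]. *)
Lemma contraction_product n (Ys Yt X2s X2t Xs Xt Xu Ysi Yti Yui Z Zi : 'M[C]_n) :
  [/\ Ysi^t* = Ysi, Yti^t* = Yti, Yui^t* = Yui, Xs^t* = Xs & Xt^t* = Xt] ->
  Xu^t* = Xu ->
  [/\ Ysi *m Ys *m Ysi = 1%:M, Yti *m Yt *m Yti = 1%:M,
     Xs *m Xs = X2s, Xt *m Xt = X2t & Xs *m Xt = Xu] ->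
  [/\ Z *m Ysi = Yui, Yui *m Z = Yti & Z *m Zi = 1%:M] ->
  psdmx (Ys - X2s) -> psdmx (Yt - X2t) ->
  psdmx (1%:M - Yui *m Xu *m Yui).
Proof.
move=> [Ysih Ytih Yuih Xsh Xth] Xuh [Ys1 Yt1 Xs2 Xt2 XsXt] [ZYs ZYt ZZi] Es Et.
set M := Yui *m Xu *m Yui.
have Mh : M = M^t* by rewrite /M !adjmxM Yuih Xuh mulmxA.
have ME := hermitian_sdiag Mh; set Q := spectralmx M in ME; set mu := eigR M in ME.
have Qu : Q \is unitarymx by exact: spectral_unitarymx.
suff mu1 j : 0 <= 1 - mu j.
  by rewrite ME -(sdiag1 Qu) sdiagB; exact: sdiag_psd.
pose v := row j Q.
have vM : v *m M = (mu j)%:C *: v.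
  rewrite /v -row_mul ME sdiagE !mulmxA (unitarymxP Qu) mul1mx row_mul.
  by rewrite row_diag_mx mxE -scalemxAl -rowE.
have v1 : (v *m v^t*) 0 0 = 1.
  have e : (Q *m Q^t*) j j = 1 by rewrite (unitarymxP Qu) mxE eqxx.
  by rewrite -e !mxE; apply: eq_bigr => i _; rewrite !mxE.
clearbody v.
(* [Z] implements the similarity: [w *m Ysi] is [v *m Yui], so the inner product of [a] and [b]
   reproduces [M] acting on its eigenvector [v] and equals mu |w|^2. *)
pose w := v *m Z.
pose a := w *m Ysi *m Xs.
pose b := w *m Yti *m Xt.
pose c := (w *m w^t*) 0 0.
have ac : (a *m a^t*) 0 0 <= c by exact: contraction_le Es.
have bc : (b *m b^t*) 0 0 <= c by exact: contraction_le Et.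
have ab : a *m b^t* = (mu j)%:C *: (w *m w^t*).
  rewrite /b !adjmxM Ytih Xth /a !mulmxA -(mulmxA _ Xs Xt) XsXt.
  rewrite -ZYt {1}/w -(mulmxA v) ZYs !mulmxA.
  rewrite (_ : v *m _ *m _ *m _ = (mu j)%:C *: v); last by rewrite -vM /M !mulmxA.
  by rewrite -!scalemxAl.
have ba : b *m a^t* = (mu j)%:C *: (w *m w^t*).
  have -> : b *m a^t* = (a *m b^t*)^t* by rewrite adjmxM trmxCK.
  have : (w *m w^t*)^t* = w *m w^t* by rewrite adjmxM trmxCK.
  rewrite ab; move: (w *m w^t*) => W {2}<-.
  apply/matrixP => p q; rewrite !mxE rmorphM /=; congr (_ * _).
  by apply: conj_Creal; apply/complex_realP; exists (mu j).
have c0 : 0 < c.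
  rewrite lt0r mulmx_adj_ge0 andbT; apply/eqP => /mulmx_adj_eq0 w0.
  have : v = w *m Zi by rewrite /w -mulmxA ZZi mulmx1.
  rewrite w0 mul0mx => v0; move: v1; rewrite v0 mul0mx mxE => /esym /eqP.
  by rewrite oner_eq0.
(* Expanding |a - b|^2 >= 0 with |a|^2, |b|^2 <= |w|^2 gives 2 (1 - mu) |w|^2 >= 0, and w is
   nonzero. *)
have := mulmx_adj_ge0 (a - b).
rewrite adjmxB mulmxBl !mulmxBr ab ba.
move: ac bc c0; rewrite /c; move: (a *m a^t*) (b *m b^t*) (w *m w^t*).
move=> A B W AW BW W0; rewrite !mxE => h.
have : 0 <= (1 - (mu j)%:C) * W 0 0 *+ 2.
  apply: (le_trans h); rewrite -subr_ge0.
  have -> : (1 - (mu j)%:C) * W 0 0 *+ 2 - (A 0 0 - (mu j)%:C * W 0 0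
     - ((mu j)%:C * W 0 0 - B 0 0)) = (W 0 0 - A 0 0) + (W 0 0 - B 0 0) by ring.
  by rewrite addr_ge0 ?subr_ge0.
by rewrite pmulrn_lge0// pmulr_lge0// -(rmorphB (real_complex R)) lecR.
Qed.

Lemma psdmx0 n : psdmx (0 : 'M[C]_n).
Proof.
split=> [|v]; first by rewrite trmx0 map_mx0.
by rewrite mulmx0 mul0mx mxE.
Qed.

Section Midpoint.
Variables (n : nat) (U V : 'M[C]_n) (x y : 'I_n -> R).
Hypotheses (Uu : U \is unitarymx) (Vu : V \is unitarymx).
Hypotheses (y0 : forall j, 0 < y j).
Local Notation X := (spow U x).
Local Notation Y := (spow V y).

(** [contraction_product] with similarity Y^((s-u)/2) yields Y^(-u/2) X^u Y^(-u/2) <= I; conjugation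
    by Y^(u/2) finishes. Negative powers are taken of the invertible [Y] only. *)
Lemma lowner_heinz_midpoint (s t : R) : 0 <= s -> 0 <= t ->
  psdmx (Y s - X s) -> psdmx (Y t - X t) ->
  psdmx (Y ((s + t) / 2) - X ((s + t) / 2)).
Proof.
move=> s0 t0 Es Et; set u := (s + t) / 2.
have u0 : 0 <= u by rewrite divr_ge0 ?addr_ge0.
have YD p q r : p + q = r -> Y p *m Y q = Y r by move=> <-; exact: spow_gt0D.
have YDD p q : q + p + q = 0 -> Y q *m Y p *m Y q = 1%:M.
  by move=> h; rewrite (YD _ _ _ erefl) (YD _ _ _ h) spow0.
have XD p q r : 0 <= p -> 0 <= q -> p + q = r -> X p *m X q = X r.
  by move=> p0 q0 <-; exact: spow_ge0D.
have M1 : psdmx (1%:M - Y (- (u / 2)) *m X u *m Y (- (u / 2))).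
  apply: (@contraction_product n (Y s) (Y t) (X s) (X t) (X (s / 2)) (X (t / 2))
    (X u) (Y (- (s / 2))) (Y (- (t / 2))) (Y (- (u / 2))) (Y ((s - u) / 2))
    (Y (- ((s - u) / 2)))) => //.
  - by split; exact: spow_adj.
  - exact: spow_adj.
  - by split; [apply: YDD|apply: YDD|apply: XD|apply: XD|apply: XD];
      rewrite ?divr_ge0 ?addr_ge0// /u; field.
  - split; [apply: YD|apply: YD|rewrite (YD _ _ 0) ?spow0// subrr//];
      by rewrite /u; field.
have := psdmx_conj (Y (u / 2)) M1; rewrite spow_adj.
have Y1 : Y (u / 2) *m Y (- (u / 2)) = 1%:M by rewrite (YD _ _ 0) ?spow0 ?subrr.
have Y2 : Y (- (u / 2)) *m Y (u / 2) = 1%:M by rewrite (YD _ _ 0) ?spow0 ?addNr.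
have Y3 : Y (u / 2) *m Y (u / 2) = Y u by apply: YD; field.
move: (Y (u / 2)) (Y (- (u / 2))) (X u) (Y u) Y1 Y2 Y3 => P P' Xu Yu Y1 Y2 <-.
rewrite mulmxBr mulmxBl mulmx1 !mulmxA Y1 mul1mx -(mulmxA Xu) Y2 mulmx1.
by [].
Qed.
End Midpoint.

(** Bisection from the exponents 0 and 1: an even numerator drops to the previous level, an odd one
    is the midpoint of two fractions of that level. *)
Lemma lowner_heinz_dyadic N k n (U V : 'M[C]_n) (x y : 'I_n -> R) :
  U \is unitarymx -> V \is unitarymx ->
  (forall j, 0 <= x j) -> (forall j, 0 < y j) ->
  psdmx (sdiag V y - sdiag U x) -> (k <= 2 ^ N)%N ->
  psdmx (spow V y (k%:R / 2 ^+ N) - spow U x (k%:R / 2 ^+ N)).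
Proof.
move=> Uu Vu x0 y0 XY.
have E0 : psdmx (spow V y 0 - spow U x 0).
  by rewrite (spow0 _ Vu) (spow0 _ Uu) subrr; exact: psdmx0.
have E1 : psdmx (spow V y 1 - spow U x 1).
  by rewrite (spow1 _ x0) (spow1 V (fun j => ltW (y0 j))).
elim: N k => [|N IH] k kN.
  rewrite expr0 divr1; case: k kN => [|[|k]] kN.
  - by rewrite mulr0n; exact: E0.
  - by rewrite mulr1n; exact: E1.
  - by exfalso; move: kN; rewrite expn0.
have half j : (j.*2)%:R / 2 ^+ N.+1 = j%:R / 2 ^+ N :> R.
  by rewrite -muln2 natrM exprS; field; rewrite expf_neq0.
have [ok|ek] := boolP (odd k); last first.
  rewrite -(even_halfK ek) half; apply: IH.
  by rewrite -leq_double -!muln2 -expnSr muln2 (even_halfK ek).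
have kE := odd_double_half k; rewrite ok add1n in kE.
have k2 : (k./2 < 2 ^ N)%N by rewrite -ltn_double -!muln2 -expnSr muln2 kE.
rewrite (_ : k%:R / _ = (k./2%:R / 2 ^+ N + k./2.+1%:R / 2 ^+ N) / 2); last first.
  by rewrite -{1}kE -muln2 -!natr1 natrM exprS; field; rewrite expf_neq0.
have P0 : 0 < 2 ^+ N :> R by rewrite exprn_gt0.
have k0 j : 0 <= j%:R / 2 ^+ N :> R by apply: divr_ge0; [exact: ler0n|exact: ltW].
exact: (lowner_heinz_midpoint Uu Vu y0 (k0 _) (k0 _) (IH _ (ltnW k2)) (IH _ k2)).
Qed.

End LownerHeinz.

(** * The inequality of Audenaert et al. *)

Section Audenaert.
Variable R : realType.
Local Notation C := (R[i]).

Lemma chernoff_sum_powR (I : finType) (k l m : I -> R) (s : R) :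
  (forall i, 0 <= l i) -> (forall i, 0 <= m i) -> 0 < s < 1 ->
  chernoff_sum k l m s = \sum_i k i * (l i `^ s * m i `^ (1 - s)).
Proof.
move=> l0 m0 /andP[s0 s1]; rewrite [RHS](bigID (common_supp l m)) /=.
rewrite [X in _ + X]big1 ?addr0; last first.
  move=> i; rewrite negb_and -!leNgt => /orP[li|mi].
    have -> : l i = 0 by apply/eqP; rewrite eq_le li l0.
    by rewrite powR0 ?mul0r ?mulr0 ?gt_eqF.
  have -> : m i = 0 by apply/eqP; rewrite eq_le mi m0.
  by rewrite powR0 ?mulr0 ?gt_eqF ?subr_gt0.
apply: eq_bigr => i /andP[li mi]; rewrite /powR !gt_eqF//.
by rewrite expRD.
Qed.

Lemma dyadic_le (f : R -> R) (c s : R) : continuous f -> 0 < s < 1 ->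
  (forall N k, (0 < k < 2 ^ N)%N -> c <= f (k%:R / 2 ^+ N)) -> c <= f s.
Proof.
move=> fc /andP[s0 s1] fd; rewrite leNgt; apply/negP => fs.
have /nbhs_ballP[e /= e0 he] : \forall x \near s, f x < c.
  exact: (cvgr_lt (f s) (fc s)).
(* A mesh below [d] places the dyadic point just under [s] inside the ball and keeps its numerator
   positive. *)
pose d := Num.min e (Num.min s (1 - s)).
have d0 : 0 < d by rewrite !lt_min e0 s0 subr_gt0 s1.
have [N hN] : exists N, 1 < d * 2 ^+ N.
  exists (Num.truncn d^-1).+1; rewrite mulrC -ltr_pdivrMr// div1r.
  apply: (lt_le_trans (truncnS_gt _)).
  by rewrite -natrX ler_nat ltnW// ltn_expl.
have P0 : 0 < 2 ^+ N :> R by rewrite exprn_gt0.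
pose k := Num.truncn (s * 2 ^+ N).
have /andP[k1 k2] : k%:R <= s * 2 ^+ N < k.+1%:R.
  by apply: truncn_itv; rewrite mulr_ge0 ?ltW.
have [de ds d1] : [/\ d <= e, d <= s & d <= 1 - s].
  by rewrite !ge_min !lexx ?orbT.
have kk : (0 < k < 2 ^ N)%N.
  apply/andP; split.
    rewrite lt0n; apply/eqP => k00; move: k2; rewrite k00 ltNge => /negP; apply.
    by rewrite (le_trans (ltW hN))// ler_pM2r.
  rewrite -(ltr_nat R) natrX; apply: (le_lt_trans k1).
  by rewrite gtr_pMl.
have /he : ball s e (k%:R / 2 ^+ N).
  rewrite /ball /= ger0_norm; last first.
    by rewrite subr_ge0 ler_pdivrMr.
  rewrite ltrBlDr -ltrBlDl ltr_pdivlMr// mulrBl ltrBlDl.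
  apply: (lt_trans k2); rewrite -natr1 addrC ltrD2r.
  by apply: (lt_le_trans hN); rewrite ler_pM2r.
by rewrite ltNge fd.
Qed.

(** Spectral projection onto the positive part of a Hermitian [D]; for [D = A - B] it is the
    Holevo-Helstrom test. *)
Definition pos_test n (D : 'M[C]_n) : 'M[C]_n :=
  sdiag (spectralmx D) (fun j => (0 < eigR D j)%R%:R).

Lemma pos_test_testmx n (D : 'M[C]_n) : testmx (pos_test D).
Proof.
rewrite /pos_test; split; first by apply: sdiag_psd => j; rewrite ler0n.
rewrite -(sdiag1 (spectral_unitarymx D)) sdiagB; apply: sdiag_psd => j.
by rewrite subr_ge0 lern1; case: (0 < _)%R.
Qed.

Lemma sdiag_mxtrace n (U : 'M[C]_n) a : U \is unitarymx ->
  \tr (sdiag U a) = (\sum_j a j)%:C.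
Proof.
move=> Uu; rewrite -[sdiag U a]mulmx1 sdiag_tr mulmx1 (unitarymxP Uu) rmorph_sum.
by apply: eq_bigr => j _; rewrite mxE eqxx mulr1.
Qed.

Lemma psd_Re_trM_le n (X Y Z : 'M[C]_n) : psdmx X -> psdmx (Z - Y) ->
  complex.Re (\tr (X *m Y)) <= complex.Re (\tr (X *m Z)).
Proof.
move=> X0 YZ; rewrite -subr_ge0 -raddfB -raddfB -mulmxBr.
exact/Re_ge0/psd_trM_ge0.
Qed.

Lemma Re_trBM n (X Y Z : 'M[C]_n) : complex.Re (\tr ((X - Y) *m Z))
  = complex.Re (\tr (Z *m X)) - complex.Re (\tr (Z *m Y)).
Proof. by rewrite mxtrace_mulC mulmxBr 2!raddfB. Qed.

(** Tr As At <= Tr As Yt = Tr As Bt + Tr As (Yt - Bt) <= Tr As Bt + Tr Ys (Yt - Bt), and Tr Ys Bt >=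
    Tr Bs Bt. *)
Lemma ozawa_trace_le n (As At Bs Bt Ys Yt : 'M[C]_n) :
  psdmx As -> psdmx Bt -> psdmx (Yt - At) -> psdmx (Yt - Bt) ->
  psdmx (Ys - As) -> psdmx (Ys - Bs) ->
  complex.Re (\tr (As *m At)) + complex.Re (\tr (Bs *m Bt))
  - complex.Re (\tr (Ys *m Yt)) <= complex.Re (\tr (As *m Bt)).
Proof.
move=> As0 Bt0 YAt YBt YAs YBs.
have h1 := psd_Re_trM_le As0 YAt.
have h2 := psd_Re_trM_le YBt YAs; rewrite 2!Re_trBM in h2.
have h3 := psd_Re_trM_le Bt0 YBs.
rewrite mxtrace_mulC (mxtrace_mulC _ Ys) in h3.
lra.
Qed.

(* Ozawa's proof of the Audenaert et al. inequality; the perturbation [eps]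
   makes the common upper bound [Y] of the two operators invertible. *)
Lemma audenaert_dyadic n (U V : 'M[C]_n) (a b : 'I_n -> R) N k :
  U \is unitarymx -> V \is unitarymx ->
  (forall i, 0 <= a i) -> (forall j, 0 <= b j) -> (0 < k < 2 ^ N)%N ->
  let A := sdiag U a in let B := sdiag V b in let T := pos_test (A - B) in
  let s := k%:R / 2 ^+ N in
  complex.Re (\tr (A *m (1%:M - T))) + complex.Re (\tr (B *m T))
  <= complex.Re (\tr (spow U a s *m spow V b (1 - s))).
Proof.
move=> Uu Vu a0 b0 /andP[k0 kN] /=.
set A := sdiag U a; set B := sdiag V b; set T := pos_test _; set s := _ / _.
have s0 : 0 <= s by rewrite divr_ge0.
have t0 : 0 <= 1 - s.
  by rewrite subr_ge0 ler_pdivrMr ?exprn_gt0// mul1r -natrX ler_nat ltnW.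
have tE : 1 - s = (2 ^ N - k)%:R / 2 ^+ N.
  rewrite natrB; last exact: ltnW.
  by rewrite natrX mulrBl divff // expf_neq0.
pose D : 'M[C]_n := A - B; pose Q := spectralmx D; pose mu := eigR D.
have Qu : Q \is unitarymx by exact: spectral_unitarymx.
have DE : D = sdiag Q mu.
  by apply: hermitian_sdiag; rewrite adjmxB !sdiag_adj.
pose pmu j := mu j * (0 < mu j)%R%:R.
have pmu0 j : 0 <= pmu j.
  by rewrite /pmu; case: ltP => h; rewrite ?mulr1 ?mulr0// ltW.
have pmul j : mu j <= pmu j.
  by rewrite /pmu; case: ltP => h; rewrite ?mulr1 ?mulr0.
(* The test keeps exactly the positive eigenvalues of [D], so the error sum is Tr A minus the trace
   of the positive part of [D]. *)
have DT : complex.Re (\tr (A *m (1%:M - T))) + complex.Re (\tr (B *m T))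
    = complex.Re (\tr A) - \sum_j pmu j.
  have e1 : complex.Re (\tr (A *m (1%:M - T)))
      = complex.Re (\tr A) - complex.Re (\tr (A *m T)).
    by rewrite mulmxBr mulmx1 2!raddfB.
  have e2 : complex.Re (\tr (A *m T)) - complex.Re (\tr (B *m T)) = \sum_j pmu j.
    have -> : complex.Re (\tr (A *m T)) - complex.Re (\tr (B *m T))
      = complex.Re (\tr (D *m T)) by rewrite mulmxBl 2!raddfB.
    rewrite {1}DE /T /pos_test -/D -/Q (sdiagM _ _ Qu).
    by rewrite (sdiag_mxtrace _ Qu).
  by rewrite e1 -e2; ring.
rewrite DT; apply/ler_addgt0Pr => e e0.
(* The perturbation costs [n * eps <= e] in trace; the denominator [n.+1] also covers dimension
   0. *)
pose eps : R := e / n.+1%:R; have eps0 : 0 < eps by rewrite divr_gt0.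
(* [Y] dominates B, and also A = B + D because the positive part dominates [D]. *)
pose Y : 'M[C]_n := B + sdiag Q (fun j => pmu j + eps).
(* A scalar matrix looks the same in every eigenbasis; read in that of [Y], it bounds the
   eigenvalues [y] below by [eps]. *)
have epsM : sdiag Q (fun=> eps) = sdiag (spectralmx Y) (fun=> eps).
  have E W : W \is unitarymx -> sdiag W (fun=> eps) = eps%:C%:M.
    move=> Wu; rewrite sdiagE (_ : diag_mx _ = eps%:C%:M).
      by rewrite mul_mx_scalar -scalemxAl unitarymxVK// scalemx1.
    by apply/matrixP => i j; rewrite !mxE.
  by rewrite (E _ _ Qu) (E _ _ (spectral_unitarymx _)).
have Yh : Y = Y^t* by rewrite adjmxD !sdiag_adj.
have YE := hermitian_sdiag Yh; set P := spectralmx Y in YE; set y := eigR Y in YE.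
have Pu : P \is unitarymx by exact: spectral_unitarymx.
have y0 j : 0 < y j.
  apply: (lt_le_trans eps0); rewrite -subr_ge0; move: j; apply: (psd_sdiag_ge0 Pu).
  rewrite -sdiagB -YE -epsM /Y -sdiagD addrA addrK.
  by apply: psdmxD; apply: sdiag_psd.
have YB : psdmx (sdiag P y - sdiag V b).
  rewrite -YE /Y addrC addKr; apply: sdiag_psd => j.
  exact: addr_ge0 (pmu0 j) (ltW eps0).
have YA : psdmx (sdiag P y - sdiag U a).
  have -> : sdiag U a = B + D by rewrite addrC subrK.
  rewrite -YE /Y opprD addrACA subrr add0r {1}DE sdiagB.
  apply: sdiag_psd => j; rewrite addrAC; apply: addr_ge0; last exact: ltW.
  by rewrite subr_ge0; exact: pmul.
have y0' j : 0 <= y j by exact: ltW.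
have kN' := ltnW kN; have kN2 := leq_subr k (2 ^ N).
have As0 : psdmx (spow U a s) by rewrite spowE; apply: sdiag_psd => j; exact: powR_ge0.
have Bt0 : psdmx (spow V b (1 - s)) by rewrite spowE; apply: sdiag_psd => j; exact: powR_ge0.
have YAt := lowner_heinz_dyadic Uu Pu a0 y0 YA kN2.
have YAs := lowner_heinz_dyadic Uu Pu a0 y0 YA kN'.
have YBt := lowner_heinz_dyadic Vu Pu b0 y0 YB kN2.
have YBs := lowner_heinz_dyadic Vu Pu b0 y0 YB kN'.
rewrite -tE -/s in YAt YAs YBt YBs.
have AE : spow U a s *m spow U a (1 - s) = A.
  by rewrite (spow_ge0D _ Uu s0 t0) addrC subrK spow1.
have BE : spow V b s *m spow V b (1 - s) = B.
  by rewrite (spow_ge0D _ Vu s0 t0) addrC subrK spow1.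
have YE' : spow P y s *m spow P y (1 - s) = Y.
  by rewrite (spow_ge0D _ Pu s0 t0) addrC subrK (spow1 _ y0') -YE.
have trY : complex.Re (\tr Y) = complex.Re (\tr B) + \sum_j pmu j + n%:R * eps.
  rewrite /Y 2!raddfD /= (sdiag_mxtrace _ Qu) -addrA; congr (_ + _).
  by rewrite mulr_natl big_split /= sumr_const card_ord.
have ne : n%:R * eps <= e.
  by rewrite /eps mulrCA -{2}[e]mulr1 ler_pM2l// ler_pdivrMr// mul1r ler_nat.
have := ozawa_trace_le As0 Bt0 YAt YBt YAs YBs.
rewrite AE BE YE' trY.
move: (complex.Re _) (complex.Re _) (complex.Re _) (\sum_j _) ne => p q r S.
move: (_ * eps) => z ne h.
lra.
Qed.

Definition pair_overlap n (U V : 'M[C]_n) (p : 'I_n * 'I_n) := overlap U V p.1 p.2.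

Lemma spow_trM n (U V : 'M[C]_n) (a b : 'I_n -> R) s :
  (forall i, 0 <= a i) -> (forall j, 0 <= b j) -> 0 < s < 1 ->
  complex.Re (\tr (spow U a s *m spow V b (1 - s)))
  = chernoff_sum (pair_overlap U V) (a \o fst) (b \o snd) s.
Proof.
move=> a0 b0 s01; rewrite !spowE sdiag_trM pair_bigA /= chernoff_sum_powR//.
- by move=> p; exact: a0.
- by move=> p; exact: b0.
Qed.

(** The test depends on the two operators only, so one test serves all exponents; continuity passes
    from dyadic [s] to real [s]. *)
Lemma audenaert n (U V : 'M[C]_n) (a b : 'I_n -> R) :
  U \is unitarymx -> V \is unitarymx ->
  (forall i, 0 <= a i) -> (forall j, 0 <= b j) ->
  exists2 T, testmx T & forall s, 0 < s < 1 ->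
  complex.Re (\tr (sdiag U a *m (1%:M - T))) + complex.Re (\tr (sdiag V b *m T))
  <= chernoff_sum (pair_overlap U V) (a \o fst) (b \o snd) s.
Proof.
move=> Uu Vu a0 b0; exists (pos_test (sdiag U a - sdiag V b)).
  exact: pos_test_testmx.
move=> s s01; apply: dyadic_le s01 _; first exact: continuous_chernoff_sum.
move=> N k kN; apply: le_trans (audenaert_dyadic Uu Vu a0 b0 kN) _.
rewrite spow_trM//; have /andP[k0 k1] := kN.
by rewrite divr_gt0 ?exprn_gt0 ?ltr0n//= ltr_pdivrMr ?exprn_gt0// mul1r -natrX ltr_nat.
Qed.
End Audenaert.

(** * Tensor powers *)

Section IidsumScale.
Variables (R : realType) (I : finType) (k l m : I -> R).

Lemma eq_iidsum n g h : (forall u v, g u v = h u v) ->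
  iidsum k l m n g = iidsum k l m n h.
Proof. by move=> gh; congr iidsum; apply: funext => u; apply: funext => v. Qed.

(** Turns weights x^n, y^n on the whole word into weights x, y on each letter. *)
Lemma iidsum_scale x y n g :
  iidsum k l m n (fun u v => g (x ^+ n * u) (y ^+ n * v))
  = iidsum k (fun i => x * l i) (fun i => y * m i) n g.
Proof.
elim: n g => [|n IH] g /=; first by rewrite !mul1r.
apply: eq_bigr => i _; congr (_ * _); rewrite -IH; apply: eq_iidsum => u v.
by rewrite !exprS; congr g; ring.
Qed.

Lemma iidsum_powR n (c e s : R) : (forall i, 0 <= l i) -> (forall i, 0 <= m i) ->
  0 <= c -> 0 <= e ->
  iidsum k l m n (fun u v => (c * u) `^ s * (e * v) `^ (1 - s))
  = c `^ s * e `^ (1 - s) * (\sum_i k i * (l i `^ s * m i `^ (1 - s))) ^+ n.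
Proof.
move=> l0 m0; elim: n c e => [|n IH] c e c0 e0 /=; first by rewrite !mulr1.
rewrite exprS mulr_suml mulr_sumr; apply: eq_bigr => i _.
rewrite (@eq_iidsum _ _ (fun u v => (c * l i * u) `^ s * (e * m i * v) `^ (1 - s))).
  by rewrite IH ?mulr_ge0// !powRM//; ring.
by move=> u v; rewrite !mulrA.
Qed.

Lemma chernoff_sum_scale (A B b : R) :
  chernoff_sum k (fun i => expR A * l i) (fun i => expR B * m i) b
  = expR (b * A + (1 - b) * B) * chernoff_sum k l m b.
Proof.
rewrite /chernoff_sum mulr_sumr; apply: eq_big => i.
  by rewrite /common_supp !pmulr_rgt0 ?expR_gt0.
rewrite /common_supp !pmulr_rgt0 ?expR_gt0// => /andP[li mi].
rewrite !lnM ?posrE ?expR_gt0// !expRK mulrCA -expRD; congr (_ * expR _); ring.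
Qed.
End IidsumScale.

Section Tensor.
Variable R : realType.
Local Notation C := (R[i]).

(** Eigenvalues of the tensor power with k + 1 factors, indexed as in [ntensmx_rec]; [d ^ k.+2] is
    convertible to [d * d ^ k.+1]. *)
Fixpoint ltens d (a : 'I_d -> R) k : 'I_(d ^ k.+1) -> R :=
  if k is k'.+1 return 'I_(d ^ k.+1) -> R then
    fun i : 'I_(d * d ^ k'.+1) =>
      a (mxtens_unindex i).1 * @ltens d a k' (mxtens_unindex i).2
  else a.
Arguments ltens {d} a k i.

Lemma big_mxtens (V : nmodType) m n (f : 'I_(m * n) -> V) :
  \sum_i f i = \sum_i \sum_j f (mxtens_index (i, j)).
Proof.
rewrite pair_bigA /= (reindex (@mxtens_index m n)) /=.
  by apply: eq_bigr => -[].
by exists (@mxtens_unindex m n) => i _; rewrite ?mxtens_indexK ?mxtens_unindexK.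
Qed.

Lemma big_pairE (V : nmodType) (I J : finType) (f : I * J -> V) :
  \sum_p f p = \sum_i \sum_j f (i, j).
Proof. by rewrite pair_bigA /=; apply: eq_bigr => -[]. Qed.

Lemma adjmx_tens (F : numClosedFieldType) m n p q (A : 'M[F]_(m, n)) (B : 'M[F]_(p, q)) :
  (A *t B)^t* = A^t* *t B^t*.
Proof. by rewrite trmx_tens map_mxT. Qed.

Lemma unitarymx_tens m n (U : 'M[C]_m) (V : 'M[C]_n) :
  U \is unitarymx -> V \is unitarymx -> U *t V \is unitarymx.
Proof.
move=> /unitarymxP Uu /unitarymxP Vu; apply/unitarymxP.
rewrite adjmx_tens tensmx_mul Uu Vu; apply/matrixP => i j.
case: (mxtens_indexP i) => i0 i1; case: (mxtens_indexP j) => j0 j1.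
rewrite tensmxE !mxE (can_eq (@mxtens_indexK _ _)) xpair_eqE.
by case: (i0 == j0); case: (i1 == j1); rewrite ?mulr0 ?mul0r ?mulr1.
Qed.

Lemma sdiag_tens m n (U : 'M[C]_m) (V : 'M[C]_n) a b :
  sdiag U a *t sdiag V b
  = sdiag (U *t V) (fun i => a (mxtens_unindex i).1 * b (mxtens_unindex i).2).
Proof.
have E : diag_mx (\row_j (a j)%:C) *t diag_mx (\row_j (b j)%:C)
    = diag_mx (\row_i (a (mxtens_unindex i).1 * b (mxtens_unindex i).2)%:C)
    :> 'M[C]_(m * n).
  apply/matrixP => i j.
  case: (mxtens_indexP i) => i0 i1; case: (mxtens_indexP j) => j0 j1.
  rewrite tensmxE !mxE (can_eq (@mxtens_indexK _ _)) xpair_eqE !mxtens_indexK /=.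
  by case: (i0 == j0); case: (i1 == j1);
    rewrite ?mulr0n ?mulr1n ?mulr0 ?mul0r// -rmorphM.
by rewrite !sdiagE -E adjmx_tens !tensmx_mul.
Qed.

Lemma unitarymx_ntens d (U : 'M[C]_d) k : U \is unitarymx ->
  ntensmx_rec U k \is unitarymx.
Proof. by move=> Uu; elim: k => [|k IH] //=; exact: unitarymx_tens. Qed.

Lemma sdiag_ntens d (U : 'M[C]_d) a k :
  ntensmx_rec (sdiag U a) k = sdiag (ntensmx_rec U k) (ltens a k).
Proof.
elim: k => [|k IH]; first by [].
by rewrite [LHS]/= IH; exact: sdiag_tens.
Qed.

Lemma ltens_mxtens d (a : 'I_d -> R) k (i : 'I_d) (j : 'I_(d ^ k.+1)) :
  ltens a k.+1 (@mxtens_index d (d ^ k.+1) (i, j)) = a i * ltens a k j.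
Proof.
rewrite -[LHS]/(a (@mxtens_unindex d (d ^ k.+1) (mxtens_index (i, j))).1
  * ltens a k (@mxtens_unindex d (d ^ k.+1) (mxtens_index (i, j))).2).
by rewrite mxtens_indexK.
Qed.

Lemma ltens_ge0 d (a : 'I_d -> R) k i : (forall j, 0 <= a j) -> 0 <= ltens a k i.
Proof.
by move=> a0; elim: k i => [|k IH] i /=; [exact: a0|rewrite mulr_ge0].
Qed.

Lemma sum_ltens d (a : 'I_d -> R) k : \sum_i a i = 1 -> \sum_i ltens a k i = 1.
Proof.
move=> a1; elim: k => [|k IH]; first exact: a1.
rewrite (@big_mxtens _ d (d ^ k.+1)) -[RHS]a1; apply: eq_bigr => i _.
under eq_bigr => j _ do rewrite ltens_mxtens.
by rewrite -mulr_sumr IH mulr1.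
Qed.

Lemma overlap_tens m n (U V : 'M[C]_m) (W Z : 'M[C]_n) i i' j j' :
  overlap (U *t W) (V *t Z) (mxtens_index (i, i')) (mxtens_index (j, j'))
  = overlap U V i j * overlap W Z i' j'.
Proof.
rewrite /overlap adjmx_tens tensmx_mul tensmxE.
by case: ((U *m _) i j) => x y; case: ((W *m _) i' j') => z t /=; ring.
Qed.

(** Overlaps and eigenvalues are multiplicative under tensor products, so the sum over pairs of
    eigenvectors of the tensor powers is a classical i.i.d. sum over k + 1 letters. *)
Lemma iidsum_ntens d (U V : 'M[C]_d) a b k g :
  \sum_p pair_overlap (ntensmx_rec U k) (ntensmx_rec V k) p
    * g (ltens a k p.1) (ltens b k p.2)
  = iidsum (pair_overlap U V) (a \o fst) (b \o snd) k.+1 g.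
Proof.
elim: k g => [|k IH] g.
  by apply: eq_bigr => p _ /=; rewrite !mulr1.
rewrite -[RHS]/(\sum_p pair_overlap U V p * iidsum (pair_overlap U V)
  (a \o fst) (b \o snd) k.+1 (fun u v => g (a p.1 * u) (b p.2 * v))).
rewrite [LHS]big_pairE [RHS]big_pairE.
rewrite (@big_mxtens _ d (d ^ k.+1)); apply: eq_bigr => i _.
under eq_bigr => i' _ do rewrite (@big_mxtens _ d (d ^ k.+1)).
rewrite exchange_big; apply: eq_bigr => j _.
rewrite -(IH (fun u v => g (a i * u) (b j * v))) big_pairE mulr_sumr; apply: eq_bigr => i' _.
rewrite mulr_sumr; apply: eq_bigr => j' _; rewrite [in RHS]/=.
rewrite !ltens_mxtens mulrA; congr (_ * _).
exact: overlap_tens.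
Qed.

End Tensor.
Arguments ltens {R d} a k i.

(** * Test errors for tensor powers of two density operators *)

Section Errors.
Variables (R : realType) (d : nat) (rho sigma : 'M[R[i]]_d).
Hypotheses (rhoD : densitymx rho) (sigmaD : densitymx sigma).
Local Notation C := (R[i]).

Local Notation K := (pair_overlap (spectralmx rho) (spectralmx sigma)).
Local Notation l := (eigR rho \o @fst 'I_d 'I_d).
Local Notation m := (eigR sigma \o @snd 'I_d 'I_d).
Local Notation F := (chernoff_sum K l m).

Let rho0 i : 0 <= eigR rho i. Proof. by apply: psd_eigR_ge0; case: rhoD. Qed.
Let sigma0 i : 0 <= eigR sigma i. Proof. by apply: psd_eigR_ge0; case: sigmaD. Qed.
Let K0 p : 0 <= K p. Proof. exact: overlap_ge0. Qed.
Let l0 p : 0 <= l p. Proof. exact: rho0. Qed.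
Let m0 p : 0 <= m p. Proof. exact: sigma0. Qed.

Lemma density_sum1 (A : 'M[C]_d) : densitymx A -> \sum_i eigR A i = 1.
Proof.
move=> [[Ah _] A1]; have := A1; rewrite {1}(hermitian_sdiag Ah).
by rewrite sdiag_mxtrace ?spectral_unitarymx// => -[].
Qed.

Lemma tpow_sdiag (A : 'M[C]_d) k : densitymx A ->
  tpow A k.+1 = sdiag (ntensmx_rec (spectralmx A) k) (ltens (eigR A) k).
Proof.
by move=> [[Ah _] _]; rewrite -sdiag_ntens -(hermitian_sdiag Ah).
Qed.

Lemma Re_tr_sdiag n (U : 'M[C]_n) a X :
  complex.Re (\tr (sdiag U a *m X))
  = \sum_j a j * complex.Re ((U *m X *m U^t*) j j).
Proof.
by rewrite sdiag_tr raddf_sum; apply: eq_bigr => i _ /=; rewrite Re_rmul.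
Qed.

Lemma Re_tr_sdiag_scale n (U : 'M[C]_n) c a X :
  complex.Re (\tr (sdiag U (fun i => c * a i) *m X))
  = c * complex.Re (\tr (sdiag U a *m X)).
Proof.
rewrite [LHS]Re_tr_sdiag; under eq_bigr => i _ do rewrite -mulrA.
rewrite -mulr_sumr; congr (_ * _); exact: esym (Re_tr_sdiag _ _ _).
Qed.

Lemma testdist_ge0 (A : 'M[C]_d) k T b : densitymx A -> testmx T ->
  0 <= testdist T (tpow A k.+1) b.
Proof.
move=> AD [T0 S0]; rewrite /testdist tpow_sdiag//.
have A0 : psdmx (sdiag (ntensmx_rec (spectralmx A) k) (ltens (eigR A) k)).
  by apply: sdiag_psd => i; apply: ltens_ge0; apply: psd_eigR_ge0; case: AD.
by case: b; apply: Re_ge0; apply: psd_trM_ge0.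
Qed.

Lemma testdist_sum1 (A : 'M[C]_d) k T : densitymx A ->
  testdist T (tpow A k.+1) true + testdist T (tpow A k.+1) false = 1.
Proof.
move=> AD; rewrite /testdist tpow_sdiag// mulmxBr mulmx1 2!raddfB /= addrC subrK.
rewrite sdiag_mxtrace ?unitarymx_ntens ?spectral_unitarymx//=.
by rewrite sum_ltens ?density_sum1.
Qed.

Lemma testdist_compl n (A T : 'M[C]_n) b :
  testdist (1%:M - T) A b = testdist T A (~~ b).
Proof. by rewrite /testdist; case: b => //=; rewrite opprB addrC subrK. Qed.

Lemma tensor_error_lb k T X Y : 0 <= X -> 0 <= Y -> testmx T ->
  iidsum K l m k.+1 (fun u v => Num.min (X * u) (Y * v))
  <= 2 * (X * testdist T (tpow rho k.+1) false
          + Y * testdist T (tpow sigma k.+1) true).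
Proof.
move=> X0 Y0 TT; rewrite -iidsum_ntens big_pairE /testdist !tpow_sdiag//.
rewrite -!Re_tr_sdiag_scale.
have Uu := unitarymx_ntens k (spectral_unitarymx rho).
have Vu := unitarymx_ntens k (spectral_unitarymx sigma).
have a0 i : 0 <= X * ltens (eigR rho) k i by rewrite mulr_ge0// ltens_ge0.
have b0 i : 0 <= Y * ltens (eigR sigma) k i by rewrite mulr_ge0// ltens_ge0.
exact: (test_error_lb Uu Vu a0 b0 TT).
Qed.

Lemma tensor_test_exists k X Y : 0 <= X -> 0 <= Y ->
  exists2 T, testmx T & forall s, 0 < s < 1 ->
  X * testdist T (tpow rho k.+1) false + Y * testdist T (tpow sigma k.+1) true
  <= X `^ s * Y `^ (1 - s) * F s ^+ k.+1.
Proof.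
move=> X0 Y0.
have Uu := unitarymx_ntens k (spectral_unitarymx rho).
have Vu := unitarymx_ntens k (spectral_unitarymx sigma).
have a0 i : 0 <= X * ltens (eigR rho) k i by rewrite mulr_ge0// ltens_ge0.
have b0 i : 0 <= Y * ltens (eigR sigma) k i by rewrite mulr_ge0// ltens_ge0.
have [T TT hT] := audenaert Uu Vu a0 b0; exists T => // s s01.
rewrite /testdist !tpow_sdiag// -!Re_tr_sdiag_scale.
apply: le_trans (hT s s01) _.
rewrite chernoff_sum_powR//; last 2 first.
- by move=> p; exact: a0.
- by move=> p; exact: b0.
rewrite (@chernoff_sum_powR _ _ K l m)//.
by rewrite -(@iidsum_powR _ _ K l m)// -iidsum_ntens.
Qed.

(** On a zero eigenvalue [mxpowR] gives 0 and [spow] gives 0^s, whence the condition on [s]. *)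
Lemma mxpowR_spow (A : 'M[C]_d) s : densitymx A -> s != 0 ->
  mxpowR A s = spow (spectralmx A) (eigR A) s.
Proof.
move=> [A0 _] s0; rewrite /mxpowR spowE sdiagE invmx_unitary; last exact: spectral_unitarymx.
congr (_ *m _); congr (_ *m diag_mx _); apply/rowP => j; rewrite !mxE /eigR.
have /mxOverP/(_ 0 j)/complex_realP[x xE] : spectral_diag A \is a mxOver Num.real.
  apply: hermitian_spectral_diag_real; apply/is_hermitianmxP.
  by rewrite expr0 scale1r; case: A0.
have := psd_eigR_ge0 A0 j; rewrite /eigR xE /= ltcR.
by case: ltgtP => // <- _; rewrite powR0.
Qed.

Lemma petzE b : 0 < b < 1 -> petz b rho sigma =
  if F b == 0 then +oo%E else ((b - 1)^-1 * ln (F b))%:E.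
Proof.
move=> b01; have /andP[b0 b1] := b01; rewrite /petz.
rewrite !mxpowR_spow ?spow_trM// ?gt_eqF// subr_gt0//.
Qed.

Lemma unitarymx1 n : (1%:M : 'M[C]_n) \is unitarymx.
Proof. by apply/unitarymxP; rewrite adjmx1 mulmx1. Qed.

Lemma Re_trM_le_sqr n (A B : 'M[C]_n) : A^t* = A -> B^t* = B ->
  2 * complex.Re (\tr (A *m B))
  <= complex.Re (\tr (A *m A)) + complex.Re (\tr (B *m B)).
Proof.
move=> Ah Bh; have : 0 <= complex.Re (\tr ((A - B) *m (A - B)^t*)).
  apply/Re_ge0/psdmx_tr_ge0; rewrite -[X in X *m _]mulmx1; apply: psdmx_conj.
  by rewrite -(sdiag1 (unitarymx1 n)); apply: sdiag_psd.
rewrite adjmxB Ah Bh (Re_trBM A B (A - B)).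
rewrite (Re_trBM A B A) (Re_trBM A B B) (mxtrace_mulC B A).
move: (complex.Re _) (complex.Re _) (complex.Re _) => x y z; lra.
Qed.

(** Tr (rho^(1/2) - sigma^(1/2))^2 >= 0 with unit traces. This is what makes the limiting divergence
    nonnegative. *)
Lemma chernoff_sum_half : F (1 / 2) <= 1.
Proof.
have h : 0 < (1 / 2 : R) < 1 by apply/andP; split; lra.
rewrite -(spow_trM _ _ rho0 sigma0 h) (_ : 1 - 1 / 2 = 1 / 2); last by field.
set A := spow _ _ _; set B := spow _ _ _.
have h0 : 0 <= 1 / 2 :> R by rewrite divr_ge0.
have hh : 1 / 2 + 1 / 2 = 1 :> R by field.
have A1 : complex.Re (\tr (A *m A)) <= 1.
  rewrite /A spow_ge0D ?spectral_unitarymx// hh spow1//.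
  by rewrite sdiag_mxtrace ?spectral_unitarymx//= density_sum1.
have B1 : complex.Re (\tr (B *m B)) <= 1.
  rewrite /B spow_ge0D ?spectral_unitarymx// hh spow1//.
  by rewrite sdiag_mxtrace ?spectral_unitarymx//= density_sum1.
have hsq := @Re_trM_le_sqr d A B (spow_adj _ _ _) (spow_adj _ _ _).
move: {hsq} (le_trans hsq (lerD A1 B1)); move: (complex.Re _) => z; lra.
Qed.

End Errors.

(** * Exponents of the two-outcome divergence *)

Section Qsum.
Variable R : realType.
Implicit Types (al a b A B M E : R).

(** The Rényi sum of (1 - a, a) and (b, 1 - b), where [a] and [b] are the errors of the first and
    second kind. *)
Definition qsum al a b : R :=
  (1 - a) `^ al * b `^ (1 - al) + a `^ al * (1 - b) `^ (1 - al).

Lemma qsum_compl al a b : qsum al (1 - a) (1 - b) = qsum al a b.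
Proof. by rewrite /qsum !subKr addrC. Qed.

Lemma half_le_powR a s : 1 / 2 <= a -> 0 <= s <= 1 -> 1 / 2 <= a `^ s.
Proof.
move=> ha /andP[s0 s1]; apply: (@le_trans _ _ ((1 / 2) `^ s)).
  by apply: ger1_powR => //; apply/andP; split; lra.
by apply: ge0_ler_powR; rewrite ?nnegrE//; lra.
Qed.

Lemma le_powR_expN al A M a : 0 <= al -> 0 <= M -> 2 <= M `^ al ->
  M <= expR A * a -> 2 * expR (- (al * A)) <= a `^ al.
Proof.
move=> al0 M0 hM Ma.
have a0 : 0 <= a by rewrite -(pmulr_rge0 _ (expR_gt0 A)) (le_trans M0).
apply: (@le_trans _ _ ((M * expR (- A)) `^ al)).
  rewrite powRM ?expR_ge0// -expRM mulNr [A * al]mulrC.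
  by rewrite ler_wpM2r ?expR_ge0.
apply: ge0_ler_powR => //; rewrite ?nnegrE ?mulr_ge0 ?expR_ge0//.
by rewrite expRN ler_pdivrMr ?expR_gt0// mulrC.
Qed.

(** One of the two weighted errors is at least [M]. The power of [M] supplies a factor 2 that pays
    for the powers of 1 - a and 1 - b, which are only known to be at least 1/2. *)
Lemma qsum_lb_half al a b A B M E : 0 < al < 1 -> 0 <= a -> 0 <= b ->
  a <= 1 / 2 -> b <= 1 / 2 -> 0 <= M -> 2 <= M `^ al -> 2 <= M `^ (1 - al) ->
  E <= expR (- (al * A)) -> E <= expR (- ((1 - al) * B)) ->
  2 * M <= expR A * a + expR B * b -> E <= qsum al a b.
Proof.
move=> /andP[al0 al1] a0 b0 a2 b2 M0 M1 M2 EA EB h.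
have ha : 1 / 2 <= (1 - a) `^ al by apply: half_le_powR; [lra|rewrite !ltW].
have hb : 1 / 2 <= (1 - b) `^ (1 - al).
  by apply: half_le_powR; [lra|apply/andP; split; lra].
have pa := powR_ge0 a al; have pb := powR_ge0 b (1 - al).
rewrite /qsum; have [Ma|Ma] := leP M (expR A * a).
  have := le_powR_expN (ltW al0) M0 M1 Ma.
  by move: EA; move: (expR _) => x Ex xa; nra.
have Mb : M <= expR B * b by lra.
have al1' : 0 <= 1 - al by lra.
have := le_powR_expN al1' M0 M2 Mb.
by move: EB; move: (expR _) => x Ex xa; nra.
Qed.

(** If both errors exceed 1/2, pass to the complementary test; if exactly one does, a single term of
    [qsum] is already at least 1/4. *)
Lemma qsum_lb al a b A B M E : 0 < al < 1 -> 0 <= a <= 1 -> 0 <= b <= 1 ->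
  0 <= M -> 2 <= M `^ al -> 2 <= M `^ (1 - al) ->
  E <= 1 / 4 -> E <= expR (- (al * A)) -> E <= expR (- ((1 - al) * B)) ->
  2 * M <= expR A * a + expR B * b ->
  2 * M <= expR A * (1 - a) + expR B * (1 - b) -> E <= qsum al a b.
Proof.
move=> al01 /andP[a0 a1] /andP[b0 b1] M0 M1 M2 E4 EA EB h1 h2.
have [al0 al1] := andP al01.
have al_itv : 0 <= al <= 1 by rewrite !ltW.
have al_itv' : 0 <= 1 - al <= 1 by apply/andP; split; lra.
have [a2|a2] := leP a (1 / 2); have [b2|b2] := leP b (1 / 2).
- exact: (qsum_lb_half al01 a0 b0 a2 b2 M0 M1 M2 EA EB h1).
- apply: (le_trans E4); rewrite /qsum.
  have p1 : 1 / 2 <= (1 - a) `^ al by apply: half_le_powR => //; lra.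
  have p2 : 1 / 2 <= b `^ (1 - al) by apply: half_le_powR => //; lra.
  have p3 := powR_ge0 a al; have p4 := powR_ge0 (1 - b) (1 - al).
  nra.
- apply: (le_trans E4); rewrite /qsum.
  have p1 : 1 / 2 <= a `^ al by apply: half_le_powR => //; lra.
  have p2 : 1 / 2 <= (1 - b) `^ (1 - al) by apply: half_le_powR => //; lra.
  have p3 := powR_ge0 (1 - a) al; have p4 := powR_ge0 b (1 - al).
  nra.
- rewrite -qsum_compl.
  by apply: (qsum_lb_half al01 _ _ _ _ M0 M1 M2 EA EB h2); lra.
Qed.

Lemma qsum_ub al a b x : 0 < al < 1 -> 0 <= a <= 1 -> 0 <= b <= 1 ->
  a `^ al <= x -> b `^ (1 - al) <= x -> qsum al a b <= 2 * x.
Proof.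
move=> /andP[al0 al1] /andP[a0 a1] /andP[b0 b1] ax bx.
have le1 u s : 0 <= s -> 0 <= u -> u <= 1 -> u `^ s <= 1.
  move=> s0 u0 u1; rewrite -[leRHS](_ : 1 `^ s = 1); last by rewrite powR1.
  by apply: ge0_ler_powR; rewrite ?nnegrE.
have p1 : (1 - a) `^ al <= 1 by apply: le1; lra.
have p2 : (1 - b) `^ (1 - al) <= 1 by apply: le1; lra.
have p1' := powR_ge0 (1 - a) al; have p2' := powR_ge0 (1 - b) (1 - al).
have p3 := powR_ge0 a al; have p4 := powR_ge0 b (1 - al).
rewrite /qsum; nra.
Qed.

Lemma qsum_ge0 al a b : 0 <= qsum al a b.
Proof. by rewrite addr_ge0// mulr_ge0// powR_ge0. Qed.

Lemma crenyi_testE d (al : R) (T rho sigma : 'M[R[i]]_d) :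
  testdist T rho true + testdist T rho false = 1 ->
  testdist T sigma true + testdist T sigma false = 1 ->
  crenyi al (testdist T rho) (testdist T sigma) =
  let s := qsum al (testdist T rho false) (testdist T sigma true) in
  if s == 0 then +oo%E else ((al - 1)^-1 * ln s)%:E.
Proof.
move=> hr hs; rewrite /crenyi big_bool /= /qsum.
have -> : 1 - testdist T rho false = testdist T rho true by rewrite -hr addrK.
by have -> : 1 - testdist T sigma true = testdist T sigma false
  by rewrite -hs addrC addKr.
Qed.

Lemma continuous_ge_closure (f : R -> R) (c : R) : continuous f ->
  (forall b, 0 < b < 1 -> c <= f b) -> forall b, 0 <= b <= 1 -> c <= f b.
Proof.
move=> fc h b /andP[b0 b1]; rewrite leNgt; apply/negP => fb.
have /nbhs_ballP[e /= e0 he] : \forall x \near b, f x < c.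
  exact: (cvgr_lt (f b) (fc b)).
pose t := Num.min e (1 / 2).
have t0 : 0 < t by rewrite lt_min e0; lra.
have te : t <= e by rewrite ge_min lexx.
have t2 : t <= 1 / 2 by rewrite ge_min lexx orbT.
(* A small move towards 1/2 enters the open interval from either endpoint. *)
pose x := b + t * (1 / 2 - b).
have /he : ball b e x.
  rewrite /ball /= /x opprD addNKr normrN normrM gtr0_norm//.
  have : `|1 / 2 - b| <= 1 / 2 by rewrite ler_norml; apply/andP; split; lra.
  by move: `|_| (normr_ge0 (1 / 2 - b)) => y y0 y1; nra.
rewrite ltNge h//; apply/andP; split; rewrite /x; nra.
Qed.

(** For error exponents A = x (1 - al) / al and B = x, the product [x * kappa al b] is b A + (1 - b)
    B. *)
Definition kappa al b : R := (1 - b) + b * ((1 - al) / al).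

End Qsum.

(** * Converse and achievability for all tests on tensor powers *)

Section Exponents.
Variables (R : realType) (d : nat) (rho sigma : 'M[R[i]]_d) (al : R).
Hypotheses (rhoD : densitymx rho) (sigmaD : densitymx sigma).
Hypothesis al01 : 0 < al < 1.
Local Notation K := (pair_overlap (spectralmx rho) (spectralmx sigma)).
Local Notation l := (eigR rho \o @fst 'I_d 'I_d).
Local Notation m := (eigR sigma \o @snd 'I_d 'I_d).
Local Notation F := (chernoff_sum K l m).

Let al0 : 0 < al. Proof. by case/andP: al01. Qed.
Let al1 : 0 < 1 - al. Proof. by rewrite subr_gt0; case/andP: al01. Qed.

Lemma tests_converse (x y : R) : x < y -> 0 < y ->
  (forall b, 0 < b < 1 -> expR (- (x * kappa al b)) <= F b) ->
  \forall n \near \oo, forall T : 'M[R[i]]_(d ^ n), testmx T ->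
  expR (- (n%:R * ((1 - al) * y)))
  <= qsum al (testdist T (tpow rho n) false) (testdist T (tpow sigma n) true).
Proof.
move=> xy y0 hF.
(* Chosen so that al A = (1 - al) B: both terms of [qsum] then decay at the same rate. *)
pose A := (1 - al) / al * y; pose B := y.
have ratio0 : 0 < (1 - al) / al by rewrite divr_gt0.
(* [mi] bounds [kappa al b] below, since [kappa al b] is a convex combination of 1 and (1 - al) /
   al. *)
have [mi [mi0 mi1 mir]] : exists mi : R, [/\ 0 < mi, mi <= 1 & mi <= (1 - al) / al].
  by exists (Num.min 1 ((1 - al) / al)); rewrite lt_min ltr01 !ge_min !lexx orbT.
pose de := (y - x) * mi.
have de0 : 0 < de by rewrite mulr_gt0 ?subr_gt0.
have hS b : 0 <= b <= 1 -> expR de <=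
    chernoff_sum K (fun i => expR A * l i) (fun i => expR B * m i) b.
  move: b; apply: continuous_ge_closure; first exact: continuous_chernoff_sum.
  move=> b b01; rewrite chernoff_sum_scale.
  apply: le_trans (ler_wpM2l (expR_ge0 _) (hF _ b01)).
  rewrite -expRD ler_expR /de /kappa /A /B.
  have /andP[b0 b1] := b01.
  move: mir; move: ((1 - al) / al) => ra mir.
  have h : mi <= 1 - b + b * ra by nra.
  have : (y - x) * mi <= (y - x) * (1 - b + b * ra).
    by rewrite ler_wpM2l// subr_ge0 ltW.
  by move=> ?; nra.
have K0 p : 0 <= K p by exact: overlap_ge0.
have l0 p : 0 <= l p by apply: psd_eigR_ge0; case: rhoD.
have m0 p : 0 <= m p by apply: psd_eigR_ge0; case: sigmaD.
have eA p : 0 <= expR A * l p by rewrite mulr_ge0 ?expR_ge0.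
have eB p : 0 <= expR B * m p by rewrite mulr_ge0 ?expR_ge0.
have [V V0 hV] := iidsum_min_chernoff K0 eA eB hS.
(* Both M^al and M^(1-al) are at least exp 1 >= 2. *)
pose M := expR (al^-1 + (1 - al)^-1).
have M1 : 2 <= M `^ al.
  rewrite /M -expRM; apply: (le_trans _ (expR_ge1Dx _)).
  rewrite mulrDl mulVf ?gt_eqF// addrA lerDl.
  by rewrite mulr_ge0 ?invr_ge0 ?ltW.
have M2 : 2 <= M `^ (1 - al).
  rewrite /M -expRM; apply: (le_trans _ (expR_ge1Dx _)).
  rewrite mulrDl mulVf ?gt_eqF// addrCA lerDr.
  by rewrite mulr_ge0 ?invr_ge0 ?ltW.
have M0 : 0 <= M by exact: expR_ge0.
(* The three thresholds make s = n de / 2 admissible for the variance bound, make exp(n de / 2)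
   exceed 8 M, and push the target below 1/4. *)
have key k : 4 * V / de ^+ 2 <= k.+1%:R -> 16 * M / de <= k.+1%:R ->
    3 / ((1 - al) * y) <= k.+1%:R -> forall T : 'M[R[i]]_(d ^ k.+1), testmx T ->
    expR (- (k.+1%:R * ((1 - al) * y))) <=
    qsum al (testdist T (tpow rho k.+1) false) (testdist T (tpow sigma k.+1) true).
  move=> nV nM n4 T TT; set n := k.+1 in nV nM n4 *.
  have n0 : 0 < n%:R :> R by rewrite ltr0n.
  have hs : n%:R * V <= (n%:R * de / 2) ^+ 2.
    move: nV; rewrite ler_pdivrMr ?exprn_gt0// => nV.
    rewrite (_ : (n%:R * de / 2) ^+ 2 = n%:R * (n%:R * de ^+ 2 / 4)); last by field.
    rewrite ler_pM2l//; move: nV; move: (_ * de ^+ 2) => z; lra.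
  have s0 : 0 < n%:R * de / 2 by rewrite divr_gt0// mulr_gt0.
  have lb := hV n _ s0 hs.
  have {lb} lb : 8 * M <= iidsum K (fun i => expR A * l i) (fun i => expR B * m i) n Num.min.
    apply: (le_trans _ lb); apply: (le_trans _ (expR_ge1Dx _)).
    move: nM; rewrite ler_pdivrMr// => nM; move: nM; move: (n%:R * de) => z nM; lra.
  have err S : testmx S -> 2 * M <=
      expR (n%:R * A) * testdist S (tpow rho n) false
      + expR (n%:R * B) * testdist S (tpow sigma n) true.
    move=> TS; have := tensor_error_lb rhoD sigmaD
      (expR_ge0 (n%:R * A)) (expR_ge0 (n%:R * B)) TS.
    rewrite -/n !expRM_natl (iidsum_scale K l m (expR A) (expR B) n Num.min) => h.
    by move: (le_trans lb h); clearbody M; move: (_ + _) => w; lra.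
  have sr := testdist_sum1 T rhoD; have ss := testdist_sum1 T sigmaD.
  have pr b := testdist_ge0 b rhoD TT; have ps b := testdist_ge0 b sigmaD TT.
  have e1 := err _ TT.
  have := err _ (testmx_compl TT); rewrite !testdist_compl /= => e2.
  have -> : n%:R * ((1 - al) * y) = al * (n%:R * A) by rewrite /A; field; rewrite gt_eqF.
  apply: (@qsum_lb _ al _ _ (n%:R * A) (n%:R * B) M) => //.
  - by have := pr true; have := pr false; rewrite -/n in sr *; lra.
  - by have := ps true; have := ps false; rewrite -/n in ss *; lra.
  - rewrite expRN (_ : al * (n%:R * A) = n%:R * ((1 - al) * y)); last first.
      by rewrite /A; field; rewrite gt_eqF.
    rewrite -div1r ler_pM// ?invr_ge0 ?expR_ge0//.
    rewrite lef_pV2 ?posrE ?expR_gt0//.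
    apply: (le_trans _ (expR_ge1Dx _)).
    by move: n4; rewrite ler_pdivrMr ?mulr_gt0// => n4; lra.
  - rewrite ler_expR (_ : al * _ = (1 - al) * (n%:R * B))// /A /B.
    by field; rewrite gt_eqF.
  - have -> : 1 - testdist T (tpow rho n) false = testdist T (tpow rho n) true.
      by rewrite -sr addrK.
    have -> : 1 - testdist T (tpow sigma n) true = testdist T (tpow sigma n) false.
      by rewrite -ss addrC addKr.
    exact: e2.
near=> n; have n1 : (0 < n)%N by near: n; exists 1%N.
rewrite -(prednK n1); apply: key; rewrite prednK//; near: n; exact: nbhs_infty_ger.
Unshelve. all: by end_near.
Qed.

(** With weights exp(n A) and exp(n B) the hypothesis makes the bound on the weighted error sum at
    most 1, so the errors are at most exp(-n A) and exp(-n B); raised to al and 1 - al, both become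
    exp(-n (1 - al) x). *)
Lemma tests_achievability (x b : R) k : 0 < b < 1 ->
  F b <= expR (- (x * kappa al b)) ->
  exists2 T, testmx T &
  qsum al (testdist T (tpow rho k.+1) false) (testdist T (tpow sigma k.+1) true)
  <= 2 * expR (- (k.+1%:R * ((1 - al) * x))).
Proof.
move=> b01 hF; set n := k.+1.
pose A := (1 - al) / al * x; pose B := x.
have [T TT hT] := tensor_test_exists rhoD sigmaD k
    (expR_ge0 (n%:R * A)) (expR_ge0 (n%:R * B)).
exists T => //; rewrite -/n.
have sr := testdist_sum1 T rhoD; have ss := testdist_sum1 T sigmaD.
have pr c := testdist_ge0 c rhoD TT; have ps c := testdist_ge0 c sigmaD TT.
rewrite -/n in sr ss pr ps.
have F0 : 0 <= F b by apply: sumr_ge0 => i _; rewrite mulr_ge0 ?expR_ge0 ?overlap_ge0.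
have h1 : expR (n%:R * A) `^ b * expR (n%:R * B) `^ (1 - b) * F b ^+ n <= 1.
  apply: (@le_trans _ _ (expR (n%:R * A) `^ b * expR (n%:R * B) `^ (1 - b)
     * expR (- (x * kappa al b)) ^+ n)).
    rewrite ler_wpM2l ?mulr_ge0 ?powR_ge0//.
    by apply: lerXn2r; rewrite ?nnegrE ?expR_ge0.
  rewrite -!expRM -expRM_natl -!expRD -[leRHS]expR0 ler_expR /A /B /kappa.

  by rewrite le_eqVlt; apply/orP; left; apply/eqP; field; rewrite gt_eqF.
have h := le_trans (hT b b01) h1; rewrite -/n in h.
have p1 := pr false; have p2 := ps true; have p3 := pr true; have p4 := ps false.
have eA := expR_gt0 (n%:R * A); have eB := expR_gt0 (n%:R * B).
have hA : testdist T (tpow rho n) false <= expR (- (n%:R * A)).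
  rewrite expRN -div1r ler_pdivlMr// mulrC; apply: le_trans h.
  by rewrite lerDl mulr_ge0 // ltW.
have hB : testdist T (tpow sigma n) true <= expR (- (n%:R * B)).
  rewrite expRN -div1r ler_pdivlMr// mulrC; apply: le_trans h.
  by rewrite lerDr mulr_ge0 // ltW.
apply: qsum_ub => //.
- by rewrite p1 /= -sr lerDr.
- by rewrite p2 /= -ss lerDl.
- apply: (@le_trans _ _ (expR (- (n%:R * A)) `^ al)).
    by apply: ge0_ler_powR => //; rewrite ?nnegrE ?expR_ge0// ltW.
  rewrite -expRM ler_expR /A le_eqVlt; apply/orP; left; apply/eqP.
  by field; rewrite gt_eqF.
- apply: (@le_trans _ _ (expR (- (n%:R * B)) `^ (1 - al))).
    by apply: ge0_ler_powR => //; rewrite ?nnegrE ?expR_ge0// ltW.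
  rewrite -expRM ler_expR /B le_eqVlt; apply/orP; left; apply/eqP.
  by ring.
Qed.
End Exponents.

(** * The Hoeffding divergence *)

Section ErealBounds.
Variable R : realType.

Lemma ereal_le_dense (A B : \bar R) :
  (forall x : R, (x%:E < A)%E -> (x%:E <= B)%E) -> (A <= B)%E.
Proof.
move=> h; rewrite leNgt; apply/negP; case: A h => [a| |]; case: B => [b| |] h //.
- rewrite lte_fin => ba; have := h ((a + b) / 2).
  rewrite lte_fin lee_fin => /(_ _) H; have : (a + b) / 2 <= b by apply: H; lra.
  by lra.
- by move=> _; have := h (a - 1); rewrite lte_fin gtrBl ltr01 => /(_ isT).
- by move=> _; have := h (b + 1); rewrite ltry lee_fin gerDl ler10 => /(_ isT).
- by move=> _; have := h 0; rewrite ltry => /(_ isT).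
Qed.

Lemma ereal_lt_dense (x : R) (A : \bar R) : (x%:E < A)%E ->
  exists2 z : R, x < z & (z%:E < A)%E.
Proof.
case: A => [a| |] //; last by move=> _; exists (x + 1); rewrite ?ltrDl ?ltry.
by rewrite lte_fin => xa; exists ((x + a) / 2); rewrite ?lte_fin; lra.
Qed.

Lemma cvg_ereal_bounds (u : nat -> \bar R) (L : \bar R) :
  (forall x : R, (x%:E < L)%E -> \forall n \near \oo, (x%:E <= u n)%E) ->
  (forall y : R, (L < y%:E)%E -> \forall n \near \oo, (u n <= y%:E)%E) ->
  u @ \oo --> L.
Proof.
case: L => [a| |] lo up.
- have near_a e : 0 < e ->
    \forall n \near \oo, ((a - e)%:E <= u n <= (a + e)%:E)%E.
    move=> e0; near=> n; apply/andP; split; near: n.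
      by apply: lo; rewrite lte_fin gtrBl.
    by apply: up; rewrite lte_fin ltrDl.
  apply/fine_cvgP; split.
    near=> n; have : ((a - 1)%:E <= u n <= (a + 1)%:E)%E.
      by near: n; exact: near_a.
    by case: (u n) => [v| |] //=; rewrite ?leye_eq ?leeNy_eq ?andbF.
  apply/cvgrPdist_le => e e0; near=> n.
  have : ((a - e)%:E <= u n <= (a + e)%:E)%E by near: n; exact: near_a.
  rewrite /=; case: (u n) => [v| |] /=; rewrite ?leye_eq ?leeNy_eq ?andbF//.
  rewrite !lee_fin => /andP[h1 h2].
  by rewrite ler_norml; apply/andP; split; lra.
- by apply/cvgeyPge => A; apply: lo; rewrite ltry.
- by apply/cvgeNyPle => A; apply: up; rewrite ltNyr.
Unshelve. all: by end_near.
Qed.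
End ErealBounds.

(** * Identification of the limit through attainable exponents *)

Section Hoeffding.
Variables (R : realType) (d : nat) (rho sigma : 'M[R[i]]_d) (al : R).
Hypotheses (rhoD : densitymx rho) (sigmaD : densitymx sigma).
Hypothesis al01 : 0 < al < 1.
Local Notation K := (pair_overlap (spectralmx rho) (spectralmx sigma)).
Local Notation l := (eigR rho \o @fst 'I_d 'I_d).
Local Notation m := (eigR sigma \o @snd 'I_d 'I_d).
Local Notation F := (chernoff_sum K l m).
Local Notation H := (hoeffding rho sigma).
Local Notation c := (al / (1 - al)).

Let al0 : 0 < al. Proof. by case/andP: al01. Qed.
Let al1 : 0 < 1 - al. Proof. by rewrite subr_gt0; case/andP: al01. Qed.
Let c0 : 0 < c. Proof. by rewrite divr_gt0. Qed.
Let cV : c^-1 = (1 - al) / al. Proof. by rewrite invf_div. Qed.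

(* The exponents attained by some [beta]; eliminating [r] from
   [r <= c H_r] leaves the bound [exp (- x (1 - beta + beta / c))]. *)
Definition attainable (x : R) : Prop :=
  exists2 b, 0 < b < 1 & F b <= expR (- (x * kappa al b)).

(** Clearing denominators. If [F b] vanishes, the Petz divergence is +oo and the negative factor (b
    - 1) / b turns the left term into +oo, so both sides are true. *)
Lemma hoeffding_term_ge (b x r : R) : 0 < b < 1 ->
  (x%:E <= ((b - 1) / b)%:E * (r%:E - petz b rho sigma))%E
  = (F b <= expR (- (b * x + (1 - b) * r))).
Proof.
move=> b01; have /andP[b0 b1] := b01.
have bN : b - 1 < 0 by rewrite subr_lt0.
have F0 : 0 <= F b by apply: sumr_ge0 => i _; rewrite mulr_ge0 ?expR_ge0 ?overlap_ge0.
rewrite petzE//; case: eqVneq => [->|Fn0].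
  rewrite expR_ge0 /= lt0_muleNy ?leey// lte_fin.
  by rewrite pmulr_llt0// invr_gt0.
have Fp : 0 < F b by rewrite lt0r Fn0.
rewrite -EFinB -EFinM lee_fin -[X in X <= expR _]lnK ?posrE// ler_expR.
have -> : (b - 1) / b * (r - (b - 1)^-1 * ln (F b)) = ((b - 1) * r - ln (F b)) / b.
  by field; rewrite gt_eqF//= lt_eqF.
rewrite ler_pdivlMr//; move: (ln _) => f.
by apply/idP/idP => h; nra.
Qed.

Lemma hoeffding_lower (b x r : R) : 0 < b < 1 ->
  F b <= expR (- (b * x + (1 - b) * r)) -> (x%:E <= H r)%E.
Proof.
move=> b01; rewrite -hoeffding_term_ge// => h; apply: le_trans h _.
by apply: ereal_sup_ubound; exists b.
Qed.

(** The supremum over beta need not be attained, hence the strict inequality. *)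
Lemma hoeffding_lt (x r : R) : (x%:E < H r)%E ->
  exists2 b, 0 < b < 1 & F b <= expR (- (b * x + (1 - b) * r)).
Proof.
by move=> /ereal_sup_gt[_ [b b01 <-]] /ltW; rewrite hoeffding_term_ge//; exists b.
Qed.

(** Take beta = 1/2: the prefactor is -1 and the divergence of order 1/2 is nonnegative. *)
Lemma hoeffding_ge_oppr (r : R) : ((- r)%:E <= H r)%E.
Proof.
have h : 0 < (1 / 2 : R) < 1 by apply/andP; split; lra.
apply: (hoeffding_lower h); apply: (le_trans (chernoff_sum_half rhoD sigmaD)).
by rewrite (_ : - _ = 0) ?expR0//; field.
Qed.

Lemma attainable_hoeffding x : attainable x -> (((1 - al) / al * x)%:E <= H x)%E.
Proof.
move=> [b b01 h]; apply: (hoeffding_lower b01); apply: le_trans h _.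
by rewrite ler_expR le_eqVlt; apply/orP; left; apply/eqP; rewrite /kappa; ring.
Qed.

(** The same beta works after lowering [r] to [x] in the exponent, as x < r. *)
Lemma lt_min_attainable (x r : R) :
  (x%:E < Order.min r%:E (c%:E * H r))%E -> attainable x.
Proof.
rewrite lt_min lte_fin => /andP[xr].
rewrite -lte_pdivrMl// cV -EFinM => /hoeffding_lt[b b01 h].
exists b => //; apply: le_trans h _; rewrite ler_expR /kappa.
have /andP[b0 b1] := b01; move: ((1 - al) / al) => z.
have : (1 - b) * x <= (1 - b) * r by apply: ler_wpM2l; [rewrite subr_ge0 ltW|exact: ltW].
by move=> ?; nra.
Qed.

Lemma scaled_hoeffding_ge (r : R) :
  (((1 - al) / al * r)%:E <= H r)%E -> (r%:E <= c%:E * H r)%E.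
Proof.
have c0' : (0 <= c%:E)%E by rewrite lee_fin ltW.
move=> /(lee_wpmul2l c0'); rewrite -EFinM mulrA -cV divff ?mul1r//.
by rewrite gt_eqF.
Qed.

Definition hoeffding_limit : \bar R := ereal_sup
  [set Order.min r%:E (c%:E * H r)%E | r in [set r : R | 0 < r]].

Lemma le_hoeffding_limit r : 0 < r -> (((1 - al) / al * r)%:E <= H r)%E ->
  (r%:E <= hoeffding_limit)%E.
Proof.
move=> r0 /scaled_hoeffding_ge h; apply: ereal_sup_ubound; exists r => //.
by rewrite min_l.
Qed.

Lemma hoeffding_limit_ge0 : (0 <= hoeffding_limit)%E.
Proof.
(* For this small [r], c H_r >= - c r = - e. *)
apply/lee_addgt0Pr => e e0; pose r := e / c.
have r0 : 0 < r by rewrite divr_gt0.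
have : ((- e)%:E <= Order.min r%:E (c%:E * H r))%E.
  rewrite le_min lee_fin; apply/andP; split; first by lra.
  have c0' : (0 <= c%:E)%E by rewrite lee_fin ltW.
  have := lee_wpmul2l c0' (hoeffding_ge_oppr r).
  by rewrite -EFinM mulrN /r mulrC divfK ?gt_eqF.
move=> h; have : ((- e)%:E <= hoeffding_limit)%E.
  by apply: (le_trans h); apply: ereal_sup_ubound; exists r.
by rewrite -(leeD2rE (x := e%:E))// -EFinD addNr.
Qed.

Lemma attainable_le_limit x : attainable x -> (x%:E <= hoeffding_limit)%E.
Proof.
move=> Gx; have [x0|x0] := leP x 0.
  by apply: le_trans hoeffding_limit_ge0; rewrite lee_fin.
by apply: le_hoeffding_limit => //; exact: attainable_hoeffding.
Qed.

Lemma lt_limit_attainable x : (x%:E < hoeffding_limit)%E -> attainable x.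
Proof. by move=> /ereal_sup_gt[_ [r r0 <-]]; exact: lt_min_attainable. Qed.

(** Every real below the limit is attainable; nonpositive ones are covered by r = 0, admissible
    because H_0 >= 0. *)
Lemma hoeffding_limit_sup : hoeffding_limit = ereal_sup [set r%:E | r in
  [set r : R | 0 <= r /\ (((1 - al) / al * r)%:E <= H r)%E]].
Proof.
apply/eqP; rewrite eq_le; apply/andP; split.
  apply: ereal_le_dense => x /lt_limit_attainable Gx.
  have [x0|x0] := leP x 0; last first.
    by apply: ereal_sup_ubound; exists x => //; split; [exact: ltW|exact: attainable_hoeffding].
  apply: (@le_trans _ _ 0%:E); first by rewrite lee_fin.
  apply: ereal_sup_ubound; exists 0 => //; split=> //=.
  by have := hoeffding_ge_oppr 0; rewrite oppr0 mulr0.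
apply: ge_ereal_sup => _ [r [r0 h] <-].
have [->|rn0] := eqVneq r 0; first exact: hoeffding_limit_ge0.
by apply: le_hoeffding_limit h; rewrite lt0r rn0.
Qed.

Lemma Dtest_seq_upper (y : R) : (hoeffding_limit < y%:E)%E ->
  \forall n \near \oo, (Dtest_seq al rho sigma n <= y%:E)%E.
Proof.
move=> Ly; have L0 := hoeffding_limit_ge0.
(* The gap between [x] and [y] is the slack consumed by the converse; no beta attains [x], as it
   lies above the limit. *)
have [x Lx xy] : exists2 x : R, (hoeffding_limit < x%:E)%E & x < y.
  move: L0 Ly; case: hoeffding_limit => [z| |] // _.
  by rewrite lte_fin => zy; exists ((z + y) / 2); rewrite ?lte_fin; lra.
have y0 : 0 < y by move: (le_lt_trans L0 Ly); rewrite lte_fin.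
have hF b : 0 < b < 1 -> expR (- (x * kappa al b)) <= F b.
  move=> b01; rewrite leNgt; apply/negP => /ltW h.
  by move: Lx; rewrite ltNge attainable_le_limit//; exists b.
have tests0 := tests_converse rhoD sigmaD al01 xy y0 hF.
near=> n; have n1 : (0 < n)%N by near: n; exists 1%N.
have : forall T : 'M[R[i]]_(d ^ n), testmx T ->
  expR (- (n%:R * ((1 - al) * y)))
  <= qsum al (testdist T (tpow rho n) false) (testdist T (tpow sigma n) true).
  by near: n; exact: tests0.
rewrite -(prednK n1); set k := n.-1 => tests.
have k0 : 0 < k.+1%:R :> R by rewrite ltr0n.
rewrite /Dtest_seq -lee_pdivlMl ?invr_gt0// invrK -EFinM.
apply: ge_ereal_sup => _ [T TT <-].
rewrite crenyi_testE ?testdist_sum1//=; have := tests T TT.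
set q := qsum _ _ _ => hq; have q0 : 0 < q by apply: lt_le_trans hq; exact: expR_gt0.
rewrite gt_eqF// lee_fin.
have : - (k.+1%:R * ((1 - al) * y)) <= ln q by rewrite -ler_expR lnK.
have -> : (al - 1)^-1 = - (1 - al)^-1 by rewrite -invrN opprB.
move=> h; rewrite mulNr lerNl ler_pdivlMl//; apply: le_trans h.
by rewrite le_eqVlt; apply/orP; left; apply/eqP; ring.
Unshelve. all: by end_near.
Qed.

Lemma Dtest_seq_lower (x : R) : (x%:E < hoeffding_limit)%E ->
  \forall n \near \oo, (x%:E <= Dtest_seq al rho sigma n)%E.
Proof.
move=> /ereal_lt_dense[z xz /lt_limit_attainable[b b01 hb]].
pose e := z - x; have e0 : 0 < e by rewrite subr_gt0.
near=> n; have n1 : (0 < n)%N by near: n; exists 1%N.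
(* From this [n] on, the gap [e] absorbs the factor 2 in the achievability bound. *)
have : ln 2 / ((1 - al) * e) <= n%:R by near: n; exact: nbhs_infty_ger.
rewrite -(prednK n1); set k := n.-1 => hn.
have k0 : 0 < k.+1%:R :> R by rewrite ltr0n.
have [T TT] := tests_achievability rhoD sigmaD al01 k b01 hb.
set q := qsum _ _ _ => hq.
rewrite /Dtest_seq -lee_pdivrMl ?invr_gt0// invrK -EFinM.
apply: (@le_trans _ _ (crenyi al (testdist T (tpow rho k.+1))
  (testdist T (tpow sigma k.+1)))); last by apply: ereal_sup_ubound; exists T.
rewrite crenyi_testE ?testdist_sum1//= -/q.
case: eqVneq => [_|q0]; first by rewrite leey.
have qp : 0 < q by rewrite lt0r q0 qsum_ge0.
rewrite lee_fin.
have lnq : ln q <= ln 2 - k.+1%:R * ((1 - al) * z).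
  rewrite -[X in _ <= X](expRK) ler_ln ?posrE ?expR_gt0//.
  by rewrite expRD lnK ?posrE.
have -> : (al - 1)^-1 = - (1 - al)^-1 by rewrite -invrN opprB.
rewrite mulNr lerNr ler_pdivrMl//; apply: (le_trans lnq).
move: hn; rewrite ler_pdivrMr ?mulr_gt0// /e => hn.
by move: hn; move: (ln 2) k.+1%:R => L2 N hn; nra.
Unshelve. all: by end_near.
Qed.

Lemma Dtest_seq_cvg : Dtest_seq al rho sigma @ \oo --> hoeffding_limit.
Proof.
by apply: cvg_ereal_bounds; [exact: Dtest_seq_lower|exact: Dtest_seq_upper].
Qed.
End Hoeffding.

Theorem mainTheorem1 (R : realType) (d : nat) (rho sigma : 'M[R[i]]_d)
    (alpha : R) :
  densitymx rho -> densitymx sigma -> 0 < alpha < 1 ->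
  let L := ereal_sup
     [set Order.min r%:E ((alpha / (1 - alpha))%:E * hoeffding rho sigma r)%E
     | r in [set r : R | 0 < r]] in
  [/\ Dtest_seq alpha rho sigma @ \oo --> L,
      Dtest_reg alpha rho sigma = L &
      L = ereal_sup [set r%:E | r in
            [set r : R | 0 <= r /\
               (((1 - alpha) / alpha * r)%:E <= hoeffding rho sigma r)%E]]].
Proof.
move=> rhoD sigmaD al01 L.
have cvgL : Dtest_seq alpha rho sigma @ \oo --> L by exact: Dtest_seq_cvg.
split; [exact: cvgL| |exact: hoeffding_limit_sup].
rewrite /Dtest_reg is_cvg_limn_esupE; last by apply/cvg_ex; exists L.
exact: cvg_lim.
Qed.
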